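(* Let $M$ be a compact smooth manifold of real dimension $d$ and let $E\to M$ be a complex vector bundle of (complex) rank $k$ equipped with a Hermitian structure. If $n\geq \lfloor d/2\rfloor+k$, then the $n$-Parseval bundle $\mathcal{P}^n(E)\to M$ admits a section; that is, $E$ admits a Parseval frame of size $n$.
   Context: A Hermitian structure on a complex vector bundle $E\to M$ is a choice of positive-definite Hermitian form on each fiber $E_p$, varying smoothly in $p\in M$. For a complex vector space $V$ of dimension $k$ with a positive-definite Hermitian form and $n\ge k$, an $n$-Parseval frame in $V$ is a complex linear map $A:\mathbb{C}^n\to V$ with $AA^\ast=I_V$, where $A^\ast$ is the adjoint (conjugate transpose) with respect to the standard Hermitian form on $\mathbb{C}^n$ and the form on $V$; equivalently, a sequence $(f_j)_{j=1}^n$ in $V$ with $\sum_{j=1}^n|\langle v,f_j\rangle|^2=\|v\|^2$ for all $v\in V$. Let $\mathcal{P}^n(V)$ denote the space of these. The $n$-Parseval bundle $\mathcal{P}^n(E)\to M$ is the fiber subbundle of $\operatorname{Hom}(M\times\mathbb{C}^n,E)$ whose fiber over $p$ is $\mathcal{P}^n(E_p)$. A Parseval frame of size $n$ for $E$ is a smooth section of $\mathcal{P}^n(E)$; equivalently, a collection of $n$ smooth sections of $E$ which form a Parseval frame of $E_p$ at each $p\in M$. *)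

(* Defs.v *)
From HB Require Import structures.
From mathcomp Require Import all_boot all_order all_algebra.
From mathcomp Require Import all_classical all_reals all_analysis.
From mathcomp Require Import complex.

Set Implicit Arguments.
Unset Strict Implicit.
Unset Printing Implicit Defensive.
Import Order.TTheory GRing.Theory Num.Theory.
Import numFieldNormedType.Exports.
Local Open Scope classical_set_scope.
Local Open Scope ring_scope.

(* C^m on an open set: all partial derivatives of order at most m exist and
   are continuous there. *)
Fixpoint Ck_on (R : realType) (d m : nat) (U : set 'rV[R]_d)
    (f : 'rV[R]_d -> R) : Prop :=
  (forall x, U x -> {for x, continuous f}) /\
  match m with
  | 0%N => True
  | m'.+1 => forall i : 'I_d,
      (forall x, U x -> derivable f x (delta_mx 0 i)) /\
      Ck_on m' U ('D_(delta_mx 0 i) f)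
  end.

Definition smooth_on (R : realType) (d : nat) (U : set 'rV[R]_d)
    (f : 'rV[R]_d -> R) : Prop := forall m, Ck_on m U f.

Lemma Ck_on_eq (R : realType) (d m : nat) (U : set 'rV[R]_d)
    (f g : 'rV[R]_d -> R) :
  open U -> (forall x, U x -> f x = g x) -> Ck_on m U f -> Ck_on m U g.
Proof.
move=> oU.
have nfg f1 g1 x : (forall y, U y -> f1 y = g1 y) -> U x ->
    {near x, f1 =1 g1 :> (_ -> R)}.
  by move=> fg Ux; apply: filterS fg _; exact: open_nbhs_nbhs.
have cont (f1 g1 : 'rV[R]_d -> R) : (forall y, U y -> f1 y = g1 y) ->
    (forall x, U x -> {for x, continuous f1}) ->
    forall x, U x -> {for x, continuous g1}.
  move=> fg cf x Ux; have := cf _ Ux.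
  rewrite /prop_for /continuous_at -fg // => cfx.
  by apply: cvg_trans cfx; 
    apply: (@near_eq_cvg _ _ _ (nbhs_filter x)); exact: nfg.
elim: m f g => [|m IH] f g fg [cf df]; split=> //.
- exact: cont fg cf.
- exact: cont fg cf.
move=> i; have [dfi Cdf] := df i; split.
  by move=> x Ux; apply: near_eq_derivable (dfi _ Ux); exact: nfg.
by apply: IH Cdf => x Ux; apply: near_eq_derive; exact: nfg.
Qed.

Lemma Ck_on_cst (R : realType) (d m : nat) (U : set 'rV[R]_d) (a : R) :
  Ck_on m U (fun=> a).
Proof.
elim: m a => [|m IH] a; split=> //.
- by move=> x _; exact: cst_continuous.
- by move=> x _; exact: cst_continuous.
move=> i; split=> [x _|]; first exact: derivable_cst.
rewrite (_ : 'D_ _ _ = fun=> 0); first exact: IH.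
by apply/funext => x; exact: derive_cst.
Qed.

(* [chart_inv] is total; only its values on the image of [chart_dom] matter. *)
Record chart (R : realType) (M : topologicalType) (d : nat) := Chart {
  chart_dom : set M ;
  chart_map :> M -> 'rV[R]_d ;
  chart_inv : 'rV[R]_d -> M ;
  chart_dom_open : open chart_dom ;
  chart_img_open : open (chart_map @` chart_dom) ;
  chart_mapK : forall p, chart_dom p -> chart_inv (chart_map p) = p ;
  chart_map_cont : forall p, chart_dom p -> {for p, continuous chart_map} ;
  chart_inv_cont : forall x, (chart_map @` chart_dom) x ->
    {for x, continuous chart_inv} }.

Definition compatible_charts (R : realType) (M : topologicalType) (d : nat)
    (c c' : chart R M d) : Prop :=
  forall i, smooth_on (c @` (chart_dom c `&` chart_dom c'))
              (fun x => c' (chart_inv c x) 0 i).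

(* The atlas need not be maximal: it determines the smooth structure. *)
Record smoothManifold (R : realType) (d : nat) := SmoothManifold {
  manifold_sort :> topologicalType ;
  manifold_hausdorff : hausdorff_space manifold_sort ;
  manifold_second_countable : @second_countable manifold_sort ;
  atlas : set (chart R manifold_sort d) ;
  atlas_cover : forall p, exists2 c, atlas c & chart_dom c p ;
  atlas_compatible : forall c c', atlas c -> atlas c' -> compatible_charts c c' }.

Section Bundles.
Context (R : realType) (d : nat) (M : smoothManifold R d).
Local Notation C := (R[i]).

Definition smooth_fun_on (U : set M) (g : M -> R) : Prop :=
  forall c, atlas c ->
    smooth_on (c @` (U `&` chart_dom c)) (fun x => g (chart_inv c x)).

Definition csmooth_fun_on (U : set M) (g : M -> C) : Prop :=
  smooth_fun_on U (fun p => complex.Re (g p)) /\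
  smooth_fun_on U (fun p => complex.Im (g p)).

Lemma open_chart_img (c : chart R M d) (U : set M) :
  open U -> open (c @` (U `&` chart_dom c)).
Proof.
move=> oU; rewrite openE => _ [p [Up cp] <-].
have cE : (c @` chart_dom c) (c p) by exists p.
have := @chart_inv_cont _ _ _ c _ cE.
rewrite /prop_for /continuous_at chart_mapK // => cinv.
have nU : nbhs (c p) (chart_inv c @^-1` U).
  by apply: cinv; exact: open_nbhs_nbhs.
have nD : nbhs (c p) (c @` chart_dom c).
  by apply: open_nbhs_nbhs; split=> //; exact: chart_img_open.
apply: filterS (filterI nU nD) => x [/= Ux [q cq qx]].
by exists q => //; split=> //; rewrite -(chart_mapK cq) qx.
Qed.

Lemma csmooth_fun_on_cst (U : set M) (a : C) : csmooth_fun_on U (fun=> a).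
Proof. by split=> c _ m; exact: Ck_on_cst. Qed.

Lemma csmooth_fun_on_eq (U : set M) (f g : M -> C) :
  open U -> (forall p, U p -> f p = g p) ->
  csmooth_fun_on U f -> csmooth_fun_on U g.
Proof.
move=> oU fg [sr si]; split=> c ac m.
  apply: Ck_on_eq (sr c ac m); first exact: open_chart_img.
  by move=> _ [p [Up cp] <-]; rewrite chart_mapK // fg.
apply: Ck_on_eq (si c ac m); first exact: open_chart_img.
by move=> _ [p [Up cp] <-]; rewrite chart_mapK // fg.
Qed.

(* Outside [triv_dom] the values of [triv_map] are irrelevant. *)
Record localTriv (F : M -> vectType C) (k : nat) := LocalTriv {
  triv_dom : set M ;
  triv_map :> forall p, 'Hom(F p, 'rV[C]_k) ;
  triv_dom_open : open triv_dom ;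
  triv_bij : forall p, triv_dom p -> bijective (triv_map p) }.

Definition local_frame (F : M -> vectType C) (k : nat) (t : localTriv F k)
    (i : 'I_k) (p : M) : F p := (t p)^-1%VF (delta_mx 0 i).

(* Row [i], column [j] of the transition matrix is the [j]-th coordinate under
   [t'] of the [i]-th frame vector of [t]. *)
Definition compatible_trivs (F : M -> vectType C) (k : nat)
    (t t' : localTriv F k) : Prop :=
  forall i j, csmooth_fun_on (triv_dom t `&` triv_dom t')
                (fun p => t' p (local_frame t i p) 0 j).

(* A complex vector bundle is given by its fibres together with a vector bundle
   atlas; the total space is [{p : M & E p}], with the manifold structure for
   which the local trivializations are diffeomorphisms. *)
Record complexBundle (k : nat) := ComplexBundle {
  fiber :> M -> vectType C ;
  trivs : set (localTriv fiber k) ;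
  trivs_cover : forall p, exists2 t, trivs t & triv_dom t p ;
  trivs_compatible : forall t t', trivs t -> trivs t' -> compatible_trivs t t' }.

Definition smooth_section (k : nat) (E : complexBundle k)
    (s : forall p, E p) : Prop :=
  forall t, trivs t -> forall j,
    csmooth_fun_on (triv_dom t) (fun p => t p (s p) 0 j).

(* Forms are linear in the first variable. *)
Record hermitianStructure (k : nat) (E : complexBundle k) :=
  HermitianStructure {
  hform :> forall p, {dot E p for Num.conj} ;
  hform_smooth : forall t, trivs t -> forall i j,
    csmooth_fun_on (triv_dom t)
      (fun p => hform p (local_frame t i p) (local_frame t j p)) }.

(* The bundle Hom(M x C^n, E): over [triv_dom t], a linear map [A] is sent to
   the list of the entries of the n x k matrix whose rows are the coordinates
   under [t] of the images by [A] of the standard basis vectors. *)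
Section HomBundle.
Context (k n : nat) (E : complexBundle k).

Definition hom_fiber (p : M) : vectType C := 'Hom('rV[C]_n, E p).

Definition hom_coord (t : localTriv E k) (p : M) (A : 'Hom('rV[C]_n, E p)) :
  'rV[C]_(n * k) := mxvec (\matrix_(i < n) t p (A (delta_mx 0 i))).

Lemma hom_coord_linear t p : linear (@hom_coord t p).
Proof.
move=> a A B; rewrite /hom_coord -linearP; congr mxvec.
apply/row_matrixP => i.
by rewrite linearP /= !rowK add_lfunE scale_lfunE linearP.
Qed.

HB.instance Definition _ t p := @GRing.isLinear.Build C
  ('Hom('rV[C]_n, E p)) ('rV[C]_(n * k)) _ (@hom_coord t p)
  (@hom_coord_linear t p).

Lemma localTriv_inv (t : localTriv E k) p : triv_dom t p ->
  cancel (t p) (t p)^-1%VF /\ cancel (t p)^-1%VF (t p).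
Proof.
move=> tp; have bt := triv_bij tp; have kt : lker (t p) == 0%VS by apply/lker0P/bij_inj.
have tK := lker0_lfunK kt; split=> //; exact/(bij_can_sym bt).
Qed.

Definition hom_inv (t : localTriv E k) p (x : 'rV[C]_(n * k)) :
    'Hom('rV[C]_n, E p) :=
  ((t p)^-1 \o linfun (mulmxr (vec_mx x)))%VF.

Lemma hom_invK t p : triv_dom t p ->
  cancel (@hom_inv t p) (@hom_coord t p) /\
  cancel (@hom_coord t p) (@hom_inv t p).
Proof.
move=> /localTriv_inv [tK tVK]; split=> [x|A].
  apply/(canLR vec_mxK)/row_matrixP => i.
  by rewrite rowK comp_lfunE lfunE /= tVK -rowE.
apply/lfunP => v; rewrite comp_lfunE lfunE /= mxvecK.
rewrite mulmx_sum_row [v in RHS]row_sum_delta !linear_sum /=.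
by apply: eq_bigr => i _; rewrite rowK !linearZ /= tK.
Qed.

Definition hom_triv_map t p : 'Hom(hom_fiber p, 'rV[C]_(n * k)) :=
  linfun (@hom_coord t p).

Lemma hom_triv_bij t p : triv_dom t p -> bijective (hom_triv_map t p).
Proof.
move=> /hom_invK[iK Ki]; exists (@hom_inv t p) => x.
  by rewrite lfunE /= Ki.
by rewrite lfunE /= iK.
Qed.

Definition hom_triv (t : localTriv E k) : localTriv hom_fiber (n * k) :=
  @LocalTriv hom_fiber (n * k) (triv_dom t) (hom_triv_map t)
    (@triv_dom_open _ _ t) (@hom_triv_bij t).

Lemma hom_triv_cover p :
  exists2 u, (hom_triv @` @trivs k E) u & triv_dom u p.
Proof.
by have [t Et tp] := trivs_cover E p; exists (hom_triv t) => //; exists t.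
Qed.

Lemma hom_triv_compatible u u' : (hom_triv @` @trivs k E) u ->
  (hom_triv @` @trivs k E) u' -> compatible_trivs u u'.
Proof.
move=> [t Et <-] [t' Et' <-] l l'.
have oU : open (triv_dom t `&` triv_dom t').
  by apply: openI; exact: triv_dom_open.
case/mxvec_indexP: l => r s; case/mxvec_indexP: l' => r' s'.
apply: (@csmooth_fun_on_eq _ (fun p =>
  if r' == r then t' p (local_frame t s p) 0 s' else 0)) => //.
  move=> p [tp _]; have [iK Ki] := hom_invK tp.
  rewrite /local_frame /= [in RHS](_ : _^-1%VF _ =
      @hom_inv t p (delta_mx 0 (mxvec_index r s))).
    rewrite lfunE /= mxvecE mxE comp_lfunE lfunE /= vec_mx_delta.
    rewrite mul_delta_mx_cond.
    by case: eqP => _; rewrite ?linear0 ?mxE.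
  have ht : lker (hom_triv_map t p) == 0%VS.
    by apply/lker0P/bij_inj/hom_triv_bij.
  by apply: (canLR (lker0_lfunK ht)); rewrite lfunE /= iK.
by case: eqP => _; [exact: trivs_compatible | exact: csmooth_fun_on_cst].
Qed.

Definition hom_bundle : complexBundle (n * k) :=
  @ComplexBundle (n * k) hom_fiber (hom_triv @` @trivs k E)
    hom_triv_cover hom_triv_compatible.

End HomBundle.

Section Parseval.
Context (k n : nat) (E : complexBundle k) (h : hermitianStructure E).

Definition is_adjoint (p : M) (A : 'Hom('rV[C]_n, E p))
    (B : 'Hom(E p, 'rV[C]_n)) : Prop :=
  forall x v, h p (A x) v = dotmx x (B v).

(* The bundle P^n(E), as a family of subsets of the fibres of Hom(M x C^n, E). *)
Definition parseval_bundle (p : M) : set (hom_bundle n E p) :=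
  [set A : 'Hom('rV[C]_n, E p) |
    exists2 B, is_adjoint A B & (A \o B)%VF = \1%VF].

Definition parseval_section (A : forall p, hom_bundle n E p) : Prop :=
  smooth_section A /\ forall p, parseval_bundle (A p).

Definition parseval_frame (f : 'I_n -> forall p, E p) : Prop :=
  (forall j, smooth_section (f j)) /\
  forall p (v : E p), \sum_(j < n) `|h p v (f j p)| ^+ 2 = h p v v.

End Parseval.

End Bundles.

(* Main.v *)
(* Local orthonormal frames weighted by bump functions give a Parseval frame of
   some finite size N, and it remains to delete vectors one at a time while
   N > floor (d/2) + k.  The vectors w fixed by the Gram matrix Pi(p) of the frame form
   the image in C^N of the fibre at p, so over all p they sweep out a set of real
   dimension at most d + 2k < 2N, and some w is fixed by no Pi(p).  This is the
   only genericity needed; it is proved by counting points of an integer grid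
   instead of by Sard's theorem.  Rotating the frame by a constant unitary matrix
   whose first row is w / |w| makes the norm of its first vector g smaller than 1
   everywhere.  The other vectors then have frame operator I - g g^*, whose
   inverse square root I + c g g^* has a closed form that depends smoothly on the
   point; applying it to them gives a Parseval frame with one vector fewer. *)

Require Import Defs.
From HB Require Import structures.
From mathcomp Require Import all_boot all_order all_algebra.
From mathcomp Require Import all_classical all_reals all_analysis.
From mathcomp Require Import complex.
From mathcomp Require Import ring lra zify.

Set Implicit Arguments.
Unset Strict Implicit.
Unset Printing Implicit Defensive.
Import Order.TTheory GRing.Theory Num.Theory.
Import numFieldNormedType.Exports.
Local Open Scope classical_set_scope.
Local Open Scope ring_scope.

(** * Functions of class C^m on open subsets of R^d *)

Section EuclideanCalculus.
Context (R : realType) (d : nat).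
Implicit Types (f g : 'rV[R]_d -> R) (U : set 'rV[R]_d) (phi : R -> R).

Lemma Ck_on_sub m U V f : V `<=` U -> Ck_on m U f -> Ck_on m V f.
Proof.
move=> VU; elim: m f => [|m IH] f /= [cf df]; split=> //; try by move=> x /VU/cf.
by move=> i; have [di Di] := df i; split; [move=> x /VU/di|exact: IH].
Qed.

Lemma Ck_on_bigcup m (I : Type) (U : I -> set 'rV[R]_d) f :
  (forall i, Ck_on m (U i) f) -> Ck_on m (\bigcup_i U i) f.
Proof.
elim: m f => [|m IH] f Uf /=; split=> //; try by move=> x [i _ Ux]; case: (Uf i) => + _; exact.
move=> j; split; first by move=> x [i _ Ux]; case: (Uf i) => _ /(_ j)[+ _]; exact.
by apply: IH => i; case: (Uf i) => _ /(_ j)[].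
Qed.

Lemma Ck_onW m U f : Ck_on m.+1 U f -> Ck_on m U f.
Proof.
elim: m f => [|m IH] f [cf df]; split=> // i; have [di Di] := df i.
by split=> //; exact: IH.
Qed.

Lemma Ck_on_add m U f g : open U ->
  Ck_on m U f -> Ck_on m U g -> Ck_on m U (fun x => f x + g x).
Proof.
move=> oU; elim: m f g => [|m IH] f g /= [cf df] [cg dg]; split=> //;
  try by move=> x Ux; apply: continuousD; [exact: cf|exact: cg].
move=> i; have [di Di] := df i; have [ei Ei] := dg i; split.
  by move=> x Ux; apply: derivableD; [exact: di|exact: ei].
apply: (Ck_on_eq oU _ (IH _ _ Di Ei)) => x Ux /=.
by rewrite deriveD //; [exact: di|exact: ei].
Qed.

Lemma Ck_on_mul m U f g : open U ->
  Ck_on m U f -> Ck_on m U g -> Ck_on m U (fun x => f x * g x).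
Proof.
move=> oU; elim: m f g => [|m IH] f g Cf Cg; have [cf df] := Cf; have [cg dg] := Cg;
  split=> //; try by move=> x Ux; apply: continuousM; [exact: cf|exact: cg].
move=> i; have [di Di] := df i; have [ei Ei] := dg i; split.
  by move=> x Ux; apply: derivableM; [exact: di|exact: ei].
apply: (Ck_on_eq oU _ (Ck_on_add oU (IH _ _ (Ck_onW Cf) Ei) (IH _ _ (Ck_onW Cg) Di))).
by move=> x Ux /=; rewrite deriveM //; [exact: di|exact: ei].
Qed.

(* Only compositions with functions of one variable occur below, so that the
   multivariate chain rule is never needed. *)
Fixpoint Ck_line (m : nat) (V : set R) phi : Prop :=
  (forall y, V y -> {for y, continuous phi}) /\
  match m with
  | 0%N => True
  | m'.+1 => exists2 psi, (forall y, V y -> is_derive y 1 phi (psi y))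
                        & Ck_line m' V psi
  end.

(** Both sides are limits of the same difference quotients, so the one-variable chain rule and mean
    value theorem transfer to directional derivatives. *)
Lemma is_derive_lineP f (z v : 'rV[R]_d) (t a : R) :
  is_derive (t *: v + z) v f a <-> is_derive t 1 (fun s => f (s *: v + z)) a.
Proof.
have E : (fun h => h^-1 *: ((f \o shift (t *: v + z)) (h *: v) - f (t *: v + z))) =
   (fun h => h^-1 *: (((fun s => f (s *: v + z)) \o shift t) (h *: (1 : R)) - f (t *: v + z))).
  by apply/funext => h /=; rewrite scalerDl addrA -[h%:A]/(h * 1) mulr1.
by split=> -[dx Dx]; split; move: dx Dx; rewrite /derivable /derive E.
Qed.

Lemma is_derive_line_comp f phi (x v : 'rV[R]_d) (a b : R) :
  is_derive (f x) 1 phi a -> is_derive x v f b ->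
  is_derive x v (phi \o f) (a * b).
Proof.
have xE : x = 0 *: v + x by rewrite scale0r add0r.
rewrite [in X in _ -> X -> _]xE [in X in _ -> _ -> X]xE => dphi /is_derive_lineP df.
apply/is_derive_lineP; apply: is_derive1_comp => //.
by rewrite scale0r add0r.
Qed.

Lemma Ck_on_comp m U V f phi : open U -> (forall x, U x -> V (f x)) ->
  Ck_line m V phi -> Ck_on m U f -> Ck_on m U (phi \o f).
Proof.
move=> oU UV; elim: m f phi UV => [|m IH] f phi UV Cp Cf; have [cp dp] := Cp; have [cf df] := Cf.
  by split=> // x Ux; apply: continuous_comp; [exact: cf | apply: cp; exact: UV].
split; first by move=> x Ux; apply: continuous_comp; [exact: cf | apply: cp; exact: UV].
move=> i; have [psi dpsi Cpsi] := dp; have [di Di] := df i.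
have D x : U x -> is_derive x (delta_mx 0 i) (phi \o f) (psi (f x) * 'D_(delta_mx 0 i) f x).
  move=> Ux; apply: is_derive_line_comp; first exact/dpsi/UV.
  by split=> //; exact: di.
split; first by move=> x /D[].
apply: (Ck_on_eq oU _ (Ck_on_mul oU (IH _ _ UV Cpsi (Ck_onW Cf)) Di)).
by move=> x /D[_ <-].
Qed.

Lemma continuous_line f (z v : 'rV[R]_d) (t : R) :
  {for t *: v + z, continuous f} -> {for t, continuous (fun s : R => f (s *: v + z))}.
Proof.
move=> cf; apply: (@continuous_comp _ _ _ (fun s : R => s *: v + z) f) => //.
by apply: continuousD; [exact: scalel_continuous|exact: cst_continuous].
Qed.

Lemma line_increment_le f (z v : 'rV[R]_d) (s B : R) : 0 <= s ->
  (forall t, t \in `[0, s] -> [/\ {for t *: v + z, continuous f},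
     derivable f (t *: v + z) v & `|'D_v f (t *: v + z)| <= B]) ->
  `|f (s *: v + z) - f z| <= B * s.
Proof.
move=> s0 H.
have [t0 t0s|t0|t /H[_ _ DB]] := @MVT_segment R (fun t => f (t *: v + z))
    (fun t => 'D_v f (t *: v + z)) 0 s s0.
- have /H[_ dt _] := subset_itv_oo_cc t0s.
  by apply/is_derive_lineP; split.
- apply: continuous_in_subspaceT => u; rewrite inE => /H[ct _ _].
  exact: continuous_line.
rewrite scale0r add0r subr0 => ->.
by rewrite normrM (ger0_norm s0) ler_wpM2r.
Qed.

(** Near x0 the partial derivatives are bounded, and y is joined to x by d axis-parallel segments,
    one increment per coordinate. The distance is measured coordinate by coordinate because the
    later pigeonhole argument cuts each coordinate separately. *)
Lemma C1_locally_lipschitz U f (x0 : 'rV[R]_d) : open U -> U x0 -> Ck_on 1 U f ->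
  exists r B : R, [/\ 0 < r, 0 <= B, ball x0 r `<=` U &
    forall x y e, ball x0 r x -> ball x0 r y ->
      (forall i, `|x 0 i - y 0 i| <= e) -> `|f x - f y| <= B * e].
Proof.
move=> oU Ux0 [cf df].
pose e i : 'rV[R]_d := delta_mx 0 i.
(* The summand 1 makes the bound strict at x0, so that it persists nearby by continuity. *)
pose B := 1 + \sum_i `|'D_(e i) f x0|.
have B0 : 0 <= B by rewrite addr_ge0 // sumr_ge0.
have : \forall x \near x0, U x /\ forall i, `|'D_(e i) f x| <= B.
  apply: filterI; first exact: open_nbhs_nbhs.
  apply: (@filter_forall _ _ (fun i x => is_true (`|'D_(e i) f x| <= B)) _ (nbhs_filter x0)) => i.
  have [_ [/(_ _ Ux0) c _]] := df i.
  have := @cvgr_norm_lt _ _ _ _ (nbhs_filter x0) _ _ c B.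
  rewrite /B (bigD1 i) //= => /(_ _)/filterS; apply => [x|]; first exact: ltW.
  by rewrite addrCA ltrDl ltr_pwDl // sumr_ge0.
move=> /nbhs_ballP[r /= r0 rP]; exists r, (d%:R * B); split => //.
- by rewrite mulr_ge0.
- by move=> x /rP[].
have step z i s : ball x0 r z -> ball x0 r (s *: e i + z) ->
    `|f (s *: e i + z) - f z| <= B * `|s|.
  (* The increment is taken along a coordinate axis, and balls are cubes. *)
  wlog s0 : z s / 0 <= s => [W bz bz'|bz bz'].
    case: (leP 0 s) => s0; first exact: W.
    rewrite distrC -(normrN s).
    have := W (s *: e i + z) (- s); rewrite scaleNr addKr; apply => //.
    by rewrite oppr_ge0 ltW.
  rewrite (ger0_norm s0); apply: line_increment_le => // t; rewrite in_itv /= => /andP[t0 ts].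
  have /rP[Ut Bt] : ball x0 r (t *: e i + z).
    split=> // a j; have [_ /(_ a j)] := bz; have [_ /(_ a j)] := bz'.
    rewrite -!ball_normE /ball_ /= !mxE /= ord1 eqxx /=; case: (j == i); rewrite ?(mulr1, mulr0, add0r) //.
    rewrite !ltr_norml => /andP[? ?] /andP[? ?]; apply/andP; split; nra.
  by split; [exact: cf|case: (df i) => + _; exact|exact: Bt].
move=> x y a bx byy xy.
(* The row [z j] has the first j coordinates of x and the remaining ones of y; it stays in the ball
   because balls are products of intervals. *)
pose z j : 'rV[R]_d := \row_i (if (i < j)%N then x 0 i else y 0 i).
have bz j : ball x0 r (z j).
  split=> // i k; rewrite !mxE ord1; have [_ /(_ 0 k)] := bx; have [_ /(_ 0 k)] := byy.
  by case: ifP.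
have <- : z d = x by apply/rowP => i; rewrite mxE ltn_ord.
have <- : z 0%N = y by apply/rowP => i; rewrite mxE ltn0.
have zP j : (j <= d)%N -> `|f (z j) - f (z 0%N)| <= j%:R * B * a.
  elim: j => [|j IH] jd; first by rewrite subrr normr0 !mul0r.
  rewrite -(subrKA (f (z j))) (le_trans (ler_normD _ _)) // -natr1 !mulrDl mul1r addrC.
  apply: lerD; first exact/IH/ltnW.
  have zS : z j.+1 = (x 0 (Ordinal jd) - y 0 (Ordinal jd)) *: e (Ordinal jd) + z j.
    apply/rowP => i; rewrite !mxE eqxx /= -val_eqE /= ltnS leq_eqVlt.
    case: (ltngtP (val i) j) => //= ij; rewrite ?mulr0 ?add0r // mulr1.
    by rewrite (_ : i = Ordinal jd) ?subrK //; exact: val_inj.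
  rewrite zS; apply: le_trans (step _ _ _ _ _) _ => //; first by rewrite -zS.
  by rewrite ler_wpM2l.
exact: zP.
Qed.

End EuclideanCalculus.

(** * Cutoff functions *)

Section SmoothCutoff.
Context (R : realType).

(* This family is closed under differentiation. *)
Definition exp_inv (P : {poly R}) (x : R) : R :=
  if 0 < x then P.[x^-1] * expR (- x^-1) else 0.

Lemma exprM_expRN_le (y : R) n : 0 <= y -> y ^+ n.+1 * expR (- y) <= n.+1`!%:R.
Proof.
move=> y0; have := expR_ge1Dxn n y0.
rewrite expRN ler_pdivrMr ?expR_gt0 // => H.
rewrite mulrC -ler_pdivrMr ?ltr0n ?fact_gt0 //.
by apply: le_trans H; rewrite lerDr.
Qed.

(** By the preceding bound at y = 1/x, each x^(-i) e^(-1/x) with x > 0 is at most (i+1)! x. This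
    linear decay is what gives derivative 0 at the origin. *)
Lemma exp_inv_le (P : {poly R}) : exists2 C : R, 0 <= C & forall x, `|exp_inv P x| <= C * `|x|.
Proof.
pose C : R := \sum_(i < size P) `|P`_i| * i.+1`!%:R.
have C0 : 0 <= C by apply: sumr_ge0 => i _; rewrite mulr_ge0.
exists C => // x; rewrite /exp_inv; case: ifP => x0; last by rewrite normr0 mulr_ge0.
rewrite horner_coef mulr_suml (le_trans (ler_norm_sum _ _ _)) // mulr_suml.
apply: ler_sum => i _; rewrite !normrM -!mulrA ler_wpM2l //.
rewrite !gtr0_norm ?expR_gt0 ?exprn_gt0 ?invr_gt0 // -ler_pdivrMr //.
have xi0 : 0 <= x^-1 by rewrite invr_ge0 ltW.
by apply: le_trans (exprM_expRN_le i xi0); rewrite exprSr mulrAC.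
Qed.

Lemma is_derive_exp_inv (P : {poly R}) (x : R) :
  is_derive x 1 (exp_inv P) (exp_inv ('X^2 * (P - P^`())) x).
Proof.
have [x0|x0|->] := ltgtP x 0.
- have E : {near x, (fun=> 0) =1 exp_inv P}.
    by near=> y; rewrite /exp_inv ltNge le_eqVlt (_ : y < 0) ?orbT //; near: y; exact: lt_nbhsl.
  rewrite /exp_inv ltNge le_eqVlt x0 orbT /=.
  split; first by apply: near_eq_derivable E _; exact: derivable_cst.
  by rewrite -(near_eq_derive _ E); exact: derive_cst.
- pose F y := P.[y^-1] * expR (- y^-1).
  have E : {near x, F =1 exp_inv P}.
    by near=> y; rewrite /exp_inv (_ : 0 < y) //; near: y; exact: lt_nbhsr.
  rewrite /exp_inv x0.
  have xn : x != 0 by rewrite gt_eqF.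
  have dV : is_derive x 1 (fun y : R => y^-1) (- x ^- 2).
    by have /(_ id 1 1 xn (is_derive_id x 1)) := @is_deriveV R _ x; rewrite /GRing.scale /= mulr1.
  have dP : is_derive x 1 (fun y => P.[y^-1]) (P^`().[x^-1] * - x ^- 2).
    apply: (@is_derive1_comp R (fun z => P.[z]) (fun y => y^-1)) => //.
    exact: is_derive_poly.
  have dN : is_derive x 1 (fun y : R => - y^-1) (x ^- 2).
    by rewrite -[x ^- 2]opprK; apply: is_deriveN.
  have de : is_derive x 1 (fun y : R => expR (- y^-1)) (expR (- x^-1) * x ^- 2).
    by apply: is_derive1_comp; exact: is_derive_expR.
  have [dF DF] := is_deriveM dP de.
  split; first by apply: near_eq_derivable E _.
  rewrite -(near_eq_derive _ E) // DF !hornerE exprVn /GRing.scale /=.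
  by ring.
(* At 0 the difference quotient is [exp_inv ('X * P) h], which tends to 0 by the linear bound. *)
- have cv : (fun h : R => h^-1 *: ((exp_inv P \o shift 0) (h *: (1 : R)) - exp_inv P 0)) @ 0^'
      --> (0 : R).
    have [C C0 CP] := exp_inv_le ('X * P).
    apply/cvgr0Pnorm_lt => e e0; near=> h.
    have h0 : h != 0 by near: h; exact: nbhs_dnbhs_neq.
    have -> : h^-1 *: ((exp_inv P \o shift 0) (h *: (1 : R)) - exp_inv P 0) = exp_inv ('X * P) h.
      rewrite /exp_inv ltxx subr0 /= addr0 [h *: 1]mulr1.
      by case: ifP => _; rewrite ?scaler0 // hornerM hornerX -mulrA.
    apply: le_lt_trans (CP h) _.
    rewrite (@le_lt_trans _ _ ((C + 1) * `|h|)) ?ler_wpM2r ?lerDl //.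
    rewrite mulrC -ltr_pdivlMr ?ltr_wpDl //.
    near: h; apply: dnbhs0_lt; by rewrite divr_gt0 // ltr_wpDl.
  rewrite {2}/exp_inv ltxx; split.
    by apply/cvg_ex; exists 0.
  exact: cvg_lim cv.
Unshelve. all: by end_near.
Qed.

Lemma Ck_line_exp_inv m V (P : {poly R}) : Ck_line m V (exp_inv P).
Proof.
have c (Q : {poly R}) (y : R) : {for y, continuous (exp_inv Q)}.
  by apply/differentiable_continuous/derivable1_diffP; case: (is_derive_exp_inv Q y).
elim: m P => [|m IH] P; split=> //.
by exists (exp_inv ('X^2 * (P - P^`()))) => [y _|]; [exact: is_derive_exp_inv|exact: IH].
Qed.

Lemma exp_inv_ge0 x : 0 <= exp_inv 1 x.
Proof. by rewrite /exp_inv; case: ifP => // _; rewrite hornerC mul1r expR_ge0. Qed.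

Lemma exp_inv_gt0 x : (0 < exp_inv 1 x) = (0 < x).
Proof. by rewrite /exp_inv; case: ifP => // _; rewrite ?hornerC ?mul1r ?expR_gt0 ?ltxx. Qed.

Lemma Ck_line_powR m (a : R) : Ck_line m [set x | 0 < x] (fun x => x `^ a).
Proof.
pose V := [set x : R | 0 < x].
(* The scalar b is carried along because each differentiation produces one. *)
suff : forall b, Ck_line m V (fun x => b * x `^ a).
  by move=> /(_ 1); under eq_fun do rewrite mul1r.
have c (b a' y : R) : V y -> is_derive y 1 (fun x => b * x `^ a') (b * a' * y `^ (a' - 1)).
  move=> y0; rewrite -mulrA.
  have := is_derive1_powR a' y0 => /(is_deriveZ b); exact.
elim: m a => [|m IH] a b; split=> //.
- by move=> y /(c b a)[+ _] => /derivable1_diffP/differentiable_continuous.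
- by move=> y /(c b a)[+ _] => /derivable1_diffP/differentiable_continuous.
exists (fun x => b * a * x `^ (a - 1)) => [y|]; [exact: c|exact: IH].
Qed.

End SmoothCutoff.

(** * Smooth functions on a manifold *)

Section SmoothFunctions.
Context (R : realType) (d : nat) (M : smoothManifold R d).
Local Notation C := (R[i]).
Implicit Types (U V : set M) (f g : M -> R).

Lemma smooth_fun_on_sub U V f : V `<=` U -> smooth_fun_on U f -> smooth_fun_on V f.
Proof.
move=> VU sf c ac m; apply: Ck_on_sub (sf c ac m).
by apply: image_subset; exact: setSI.
Qed.

Lemma smooth_fun_on_bigcup (I : Type) (U : I -> set M) f :
  (forall i, smooth_fun_on (U i) f) -> smooth_fun_on (\bigcup_i U i) f.
Proof.
move=> sf c ac m; rewrite setI_bigcupl image_bigcup; apply: Ck_on_bigcup => i.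
exact: sf.
Qed.

Lemma smooth_fun_onU U V f :
  smooth_fun_on U f -> smooth_fun_on V f -> smooth_fun_on (U `|` V) f.
Proof.
move=> fU fV; apply: (@smooth_fun_on_sub (\bigcup_(b : bool) if b then U else V)).
  by move=> p [Up|Vp]; [exists true|exists false].
by apply: smooth_fun_on_bigcup => -[].
Qed.

Lemma smooth_fun_on_eq U f g : open U -> (forall p, U p -> f p = g p) ->
  smooth_fun_on U f -> smooth_fun_on U g.
Proof.
move=> oU fg sf c ac m; apply: Ck_on_eq (sf c ac m); first exact: open_chart_img.
by move=> _ [p [Up cp] <-]; rewrite chart_mapK // fg.
Qed.

Lemma smooth_fun_on_cst U (a : R) : smooth_fun_on U (fun=> a).
Proof. by move=> c ac m; exact: Ck_on_cst. Qed.

Lemma smooth_fun_onD U f g : open U ->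
  smooth_fun_on U f -> smooth_fun_on U g -> smooth_fun_on U (fun p => f p + g p).
Proof.
move=> oU sf sg c ac m.
exact: (Ck_on_add (f := f \o chart_inv c) (g := g \o chart_inv c)
  (open_chart_img (c := c) oU) (sf c ac m) (sg c ac m)).
Qed.

Lemma smooth_fun_onM U f g : open U ->
  smooth_fun_on U f -> smooth_fun_on U g -> smooth_fun_on U (fun p => f p * g p).
Proof.
move=> oU sf sg c ac m.
exact: (Ck_on_mul (f := f \o chart_inv c) (g := g \o chart_inv c)
  (open_chart_img (c := c) oU) (sf c ac m) (sg c ac m)).
Qed.

Lemma smooth_fun_onN U f : open U -> smooth_fun_on U f -> smooth_fun_on U (fun p => - f p).
Proof.
move=> oU sf; have := smooth_fun_onM oU (smooth_fun_on_cst U (-1)) sf.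
by under eq_fun do rewrite mulN1r.
Qed.

Lemma smooth_fun_on_prod U (I : Type) (r : seq I) (F : I -> M -> R) : open U ->
  (forall i, smooth_fun_on U (F i)) -> smooth_fun_on U (fun p => \prod_(i <- r) F i p).
Proof.
move=> oU sF; elim: r => [|i r IH].
  by under eq_fun do rewrite big_nil; exact: smooth_fun_on_cst.
by under eq_fun do rewrite big_cons; exact: (smooth_fun_onM oU (sF i) IH).
Qed.

Lemma smooth_fun_on_comp U (V : set R) f (phi : R -> R) : open U ->
  (forall p, U p -> V (f p)) -> (forall m, Ck_line m V phi) ->
  smooth_fun_on U f -> smooth_fun_on U (phi \o f).
Proof.
move=> oU UV sphi sf c ac m.
apply: (Ck_on_comp (f := f \o chart_inv c) (open_chart_img (c := c) oU) _ (sphi m) (sf c ac m)).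
by move=> _ [p [Up cp] <-]; rewrite /= chart_mapK //; exact: UV.
Qed.

Lemma smooth_fun_on_powR U f (a : R) : open U -> (forall p, U p -> 0 < f p) ->
  smooth_fun_on U f -> smooth_fun_on U (fun p => f p `^ a).
Proof.
move=> oU f0; exact: (smooth_fun_on_comp oU f0 (fun m => Ck_line_powR m a)).
Qed.

Lemma smooth_fun_on_coord (c : chart R M d) (i : 'I_d) : atlas c ->
  smooth_fun_on (chart_dom c) (fun p => c p 0 i).
Proof. by move=> ac c' ac'; rewrite setIC; exact: atlas_compatible. Qed.

(** The bump is a product of [exp_inv] factors in chart coordinates, extended by 0. It vanishes off
    K, the image of a closed cube, which is compact and hence closed as M is Hausdorff; objects
    multiplied by the bump can then be glued to 0 on the open complement of K. *)
Lemma smooth_bump (p0 : M) (U : set M) : open U -> U p0 ->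
  exists b : M -> R, [/\ smooth_fun_on setT b, forall p, 0 <= b p, \forall p \near p0, 0 < b p &
    exists2 K, closed K & K `<=` U /\ forall p, ~ K p -> b p = 0].
Proof.
move=> oU Up0; have [c ac cp0] := atlas_cover p0.
have oUc : open (c @` (U `&` chart_dom c)) by exact: open_chart_img.
have Uc0 : (c @` (U `&` chart_dom c)) (c p0) by exists p0.
have /nbhs_ballP[r /= r0 rU] : nbhs (c p0) (c @` (U `&` chart_dom c)).
  exact: open_nbhs_nbhs.
pose s := r / 2; have s0 : 0 < s by rewrite divr_gt0.
pose B := [set x : 'rV[R]_d | forall i, `|x 0 i - c p0 0 i| <= s].
have BU : B `<=` c @` (U `&` chart_dom c).
  move=> x Bx; apply: rU; split=> // i j; rewrite ord1 -ball_normE /ball_ /= distrC.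
  by apply: le_lt_trans (Bx j) _; rewrite /s ltr_pdivrMr // ltr_pMr // ltr1n.
pose K := chart_inv c @` B.
have cB : compact B.
  have := @rV_compact R d (fun i => [set` `[c p0 0 i - s, c p0 0 i + s]]).
  rewrite (_ : [set _ | _] = B); first by apply => i; exact: segment_compact.
  by apply/seteqP; split => x Bx i; move: (Bx i); rewrite /= in_itv /= ler_distl.
have cK : closed K.
  apply: compact_closed; first exact: manifold_hausdorff.
  apply: continuous_compact cB.
  apply: continuous_in_subspaceT => x; rewrite inE => /BU[p [Up cp] <-].
  by apply: chart_inv_cont; exists p.
have KU : K `<=` U `&` chart_dom c.
  by move=> _ [x /BU[p [Up cp] <-] <-]; rewrite chart_mapK.
pose beta p := \prod_i exp_inv 1 (s ^+ 2 - (c p 0 i - c p0 0 i) ^+ 2).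
pose b p := if `[< chart_dom c p >] then beta p else 0.
have b0 p : ~ K p -> b p = 0.
  move=> Kp; rewrite /b; case: asboolP => // cp.
  have [i /negP] : exists i, ~ (`|c p 0 i - c p0 0 i| <= s).
    apply: contrapT => /forallNP H; apply: Kp; exists (c p); last exact: chart_mapK.
    by move=> i; have /contrapT := H i.
  rewrite -ltNge => si; rewrite /beta (bigD1 i) //= [X in X * _](_ : _ = 0) ?mul0r //.
  apply/eqP; rewrite eq_le exp_inv_ge0 andbT leNgt exp_inv_gt0 subr_gt0 -leNgt.
  by rewrite -[leRHS]real_normK ?num_real // ler_pXn2r ?nnegrE // ltW // ltW.
exists b; split.
(* Smoothness is checked on two open sets covering M: the chart domain, where b is [beta], and the
   complement of K, where b is 0. *)
- rewrite (_ : setT = chart_dom c `|` ~` K); last first.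
    apply/seteqP; split=> p // _; have [/KU[_ ?]|?] := pselect (K p); by [left|right].
  apply: smooth_fun_onU.
    have oc := @chart_dom_open _ _ _ c.
    apply: (@smooth_fun_on_eq _ beta) => // [p cp|]; first by rewrite /b asboolT.
    apply: smooth_fun_on_prod => // i.
    apply: (smooth_fun_on_comp (V := setT) (phi := exp_inv 1)) => //.
      by move=> m; exact: Ck_line_exp_inv.
    have sc : smooth_fun_on (chart_dom c) (fun p => c p 0 i - c p0 0 i).
      by apply: smooth_fun_onD => //; [exact: smooth_fun_on_coord|exact: smooth_fun_on_cst].
    apply: smooth_fun_onD => //; first exact: smooth_fun_on_cst.
    by apply: smooth_fun_onN => //; exact: smooth_fun_onM.
  apply: (@smooth_fun_on_eq _ (fun=> 0)); first exact: closed_openC.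
    by move=> p /b0.
  exact: smooth_fun_on_cst.
- move=> p; rewrite /b; case: asboolP => // _; apply: prodr_ge0 => i _; exact: exp_inv_ge0.
- have : \forall p \near p0, chart_dom c p /\ ball (c p0) s (c p).
    apply: filterI; first by apply: open_nbhs_nbhs; split=> //; exact: chart_dom_open.
    by apply: (chart_map_cont cp0); exact: nbhsx_ballx.
  apply: filterS => p [cp [_ /(_ 0) cb]]; rewrite /b asboolT //; apply: prodr_gt0 => i _.
  have := cb i; rewrite -ball_normE /ball_ /= distrC => cs.
  by rewrite exp_inv_gt0 subr_gt0 -[ltLHS]real_normK ?num_real // ltr_pXn2r ?nnegrE // ltW.
- by exists K => //; split=> // p /KU[].
Qed.

End SmoothFunctions.

(** If P failed for the whole space, the complements of the sets satisfying P would form a proper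
    filter. At a cluster point p of it, the neighbourhood V given for p would have to meet its own
    complement. *)
Lemma compact_ind (T : topologicalType) (P : set T -> Prop) : compact [set: T] ->
  P set0 -> (forall A B, A `<=` B -> P B -> P A) ->
  (forall A B, P A -> P B -> P (A `|` B)) ->
  (forall p : T, exists2 V, nbhs p V & P V) -> P setT.
Proof.
move=> cT P0 PS PU Ploc; pose F : set_system T := [set A | P (~` A)].
have fF : Filter F.
  split; first by rewrite /F /= setCT.
  - by move=> A B FA FB; rewrite /F /= setCI; exact: PU.
  - by move=> A B AB; apply: PS; exact: subsetC.
apply: contrapT => nP.
have pF : ProperFilter F.
  apply: Build_ProperFilter_ex => // A FA; apply: contrapT => /forallNP A0.
  by apply: nP; apply: PS FA => p _ /A0.
have [p [_ /(_ (~` _) _) cp]] := cT F pF (filterT).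
have [V nV PV] := Ploc p.
by have [q []] : ~` V `&` V !=set0 by apply: cp => //; rewrite /F /= setCK.
Qed.

(** * Vectors fixed by no member of a family of matrices *)

Section Pigeonhole.
Context (R : realType).

Lemma cell_partition (s : R) (Q : nat) : 0 < s -> (0 < Q)%N ->
  exists cell : R -> 'I_Q, forall a b, `|a| < s -> `|b| < s ->
    cell a = cell b -> `|a - b| <= 2 * s / Q%:R.
Proof.
(* The map u sends (-s, s) affinely onto (0, [Q.+1]), and the cell is the integer part of u. *)
case: Q => // Q s0 _; pose u (a : R) := (a + s) / (2 * s) * Q.+1%:R.
exists (fun a => inord (Num.truncn (u a))) => a b.
have s2 : 0 < 2 * s by rewrite mulr_gt0.
have uP x : `|x| < s -> (Num.truncn (u x) < Q.+1)%N /\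
    (Num.truncn (u x))%:R <= u x < (Num.truncn (u x)).+1%:R.
  rewrite ltr_norml => /andP[sx xs].
  have u0 : 0 <= u x by rewrite mulr_ge0 // divr_ge0 ?ltW //; lra.
  have tu := truncn_itv u0; split=> //; have /andP[tl _] := tu.
  rewrite -(ltr_nat R); apply: le_lt_trans tl _.
  by rewrite /u gtr_pMl // ltr_pdivrMr // mul1r; lra.
move=> /uP[ua /andP[al ar]] /uP[ub /andP[bl br]] /(congr1 val) /=.
rewrite !inordK // => E; rewrite E in al ar.
have : `|u a - u b| <= 1.
  by rewrite ler_norml -natr1 in ar br *; apply/andP; split; lra.
have -> : u a - u b = (a - b) * (Q.+1%:R / (2 * s)).
  by rewrite /u; field; rewrite gt_eqF.
rewrite normrM [X in _ * X]gtr0_norm ?divr_gt0 //.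
by rewrite -ler_pdivlMr ?divr_gt0 // mul1r invf_div.
Qed.

(** The fixed rows form the left kernel W of 1 - P, which lies in the row space of P. Choosing dim W
    coordinates that are injective on W makes x |-> (x (1 - P), x restricted to f) injective; B is
    the block of a right inverse that multiplies x (1 - P). *)
Lemma fixed_coordinates (N : nat) (P : 'M[R]_N) :
  exists r (f : 'I_r -> 'I_N) (B : 'M[R]_N), (r <= \rank P)%N /\
    forall x : 'rV_N, (forall a, x 0 (f a) = 0) -> x = x *m (1%:M - P) *m B.
Proof.
pose W := kermx (1%:M - P).
have WP : (W <= P)%MS.
  have /eqP := mulmx_ker (1%:M - P); rewrite -/W mulmxBr mulmx1 subr_eq0 => /eqP WE.
  by rewrite [X in (X <= _)%MS]WE submxMl.
pose f := maxrankfun W^T.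
pose J := colsub f (1%:M : 'M[R]_N).
have xJ q (x : 'M[R]_(q, N)) : x *m J = colsub f x by rewrite mulmx_colsub mulmx1.
have rJ : \rank (W *m J) = \rank W.
  by rewrite xJ -mxrank_tr trmx_mxsub [LHS](eq_maxrowsub W^T) mxrank_tr.
pose D := row_mx (1%:M - P) J.
have fD : row_free D.
  apply: inj_row_free => x; rewrite mul_mx_row -[0]row_mx0 => /eq_row_mx[xP xJ0].
  have /submxP[y xE] : (x <= W)%MS by apply/sub_kermxP.
  have : (y <= kermx (W *m J))%MS by apply/sub_kermxP; rewrite mulmxA -xE.
  have /eqmxP kW : (kermx W == kermx (W *m J))%MS.
    rewrite -(geq_leqif (mxrank_leqif_eq _)); first by rewrite [leqLHS]mxrank_ker rJ -mxrank_ker.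
    by apply/sub_kermxP; rewrite mulmxA mulmx_ker mul0mx.
  by rewrite -kW => /sub_kermxP; rewrite -xE.
exists (\rank W^T), f, (usubmx (pinvmx D)); split; first by rewrite mxrank_tr mxrankS.
move=> x x0; rewrite -[LHS]mulmx1 -[X in _ *m X = _](mulmxVp fD) mulmxA mul_mx_row.
rewrite -{1}[pinvmx D]vsubmxK mul_row_col [x *m J](_ : _ = 0) ?mul0mx ?addr0 //.
by rewrite xJ; apply/rowP => a; rewrite !mxE.
Qed.

Definition grid_row (N L : nat) (g : {ffun 'I_N -> 'I_L}) : 'rV[R]_N :=
  \row_j (g j)%:R.

Lemma normr_mulmx_le N (x : 'rV[R]_N) (A : 'M[R]_N) (a e : R) j :
  (forall i, `|x 0 i| <= a) -> (forall i, `|A i j| <= e) -> 0 <= e ->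
  `|(x *m A) 0 j| <= N%:R * (a * e).
Proof.
move=> xa Ae e0; rewrite mxE (le_trans (ler_norm_sum _ _ _)) //.
rewrite mulr_natl -[N in _ *+ N]card_ord -sumr_const; apply: ler_sum => i _.
by rewrite normrM ler_pM.
Qed.

(* Two grid points fixed by nearby matrices coincide as soon as they agree in the
   coordinates f of [fixed_coordinates]: x := g - h satisfies
   x (1 - P0) = h (P - Q) + x (P - P0), and the last term is absorbed in x. *)
Lemma fixed_rows_eq N (P0 B : 'M[R]_N) r (f : 'I_r -> 'I_N) (b del e : R) :
  (forall x : 'rV_N, (forall a, x 0 (f a) = 0) -> x = x *m (1%:M - P0) *m B) ->
  0 <= del -> 0 <= e -> 0 <= b ->
  (forall i j, `|B i j| <= b) -> N%:R ^+ 3 * b * del <= 2^-1 ->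
  forall (P Q : 'M[R]_N) L (g h : {ffun 'I_N -> 'I_L}),
  2 * N%:R ^+ 3 * b * L%:R * e < 1 ->
  (forall i j, `|P i j - P0 i j| <= del) -> (forall i j, `|P i j - Q i j| <= e) ->
  grid_row g *m P = grid_row g -> grid_row h *m Q = grid_row h ->
  (forall a, g (f a) = h (f a)) -> g = h.
Proof.
move=> BP del0 e0 b0 Bb bdel P Q L g h Le PP0 PQ gP hQ gh.
pose x := grid_row g - grid_row h.
pose y := x *m (1%:M - P0).
have yE : y = grid_row h *m (P - Q) + x *m (P - P0).
  rewrite /y /x !(mulmxBl, mulmxBr) mulmx1 gP hQ mulmx1.
  by apply/rowP => i; rewrite !mxE; ring.
pose a := \sum_j `|x 0 j|.
have a0 : 0 <= a by apply: sumr_ge0.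
have xa i : `|x 0 i| <= a by rewrite /a (bigD1 i) //= lerDl sumr_ge0.
have ya j : `|y 0 j| <= N%:R * (L%:R * e) + N%:R * (a * del).
  rewrite yE mxE (le_trans (ler_normD _ _)) //; apply: lerD; apply: normr_mulmx_le => // i.
  - by rewrite mxE ger0_norm // ler_nat ltnW.
  - by rewrite !mxE.
  - by rewrite !mxE.
(* Summing over j gives a <= N^3 b (L e + a del). Since N^3 b del <= 1/2, half of a is absorbed on
   the left, whence the factor 2. *)
have aE : a <= 2 * N%:R ^+ 3 * b * L%:R * e.
  have : a <= \sum_(j < N) N%:R * ((N%:R * (L%:R * e) + N%:R * (a * del)) * b).
    apply: ler_sum => j _; rewrite {1}(BP x); last by move=> i; rewrite !mxE gh subrr.
    exact: normr_mulmx_le.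
  rewrite sumr_const card_ord -mulr_natl.
  have : a * (N%:R ^+ 3 * b * del) <= a * 2^-1 by rewrite ler_wpM2l.
  lra.
(* The coordinates are integers, so a difference smaller than 1 vanishes. *)
apply/ffunP => j; apply: val_inj => /=.
have := le_lt_trans (xa j) (le_lt_trans aE Le).
rewrite !mxE; case: (ltngtP (g j) (h j)) => // gh1; rewrite ltNge => /negP[].
  by rewrite distrC -natrB 1?ltnW // ger0_norm // ler1n subn_gt0.
by rewrite -natrB 1?ltnW // ger0_norm // ler1n subn_gt0.
Qed.

End Pigeonhole.

(** * Counting the grid points fixed by a smooth family of matrices *)

Section GenericVector.
Context (R : realType) (d : nat) (M : smoothManifold R d).

Definition fixed_grid (N L : nat) (Pi : M -> 'M[R]_N) (A : set M) :
    {set {ffun 'I_N -> 'I_L}} :=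
  [set g | `[< exists2 p, A p & grid_row R g *m Pi p = grid_row R g >]].

Lemma fixed_gridP N L (Pi : M -> 'M[R]_N) A (g : {ffun 'I_N -> 'I_L}) :
  reflect (exists2 p, A p & grid_row R g *m Pi p = grid_row R g)
    (g \in fixed_grid L Pi A).
Proof. by rewrite inE; exact: asboolP. Qed.

(* A grid point fixed somewhere in V is determined by at most k of its
   coordinates and by one of the O(L^d) cells of side O(1/L) containing the point
   where it is fixed. *)
Lemma fixed_grid_local_le N k (Pi : M -> 'M[R]_N) (p0 : M) :
  (forall i j, smooth_fun_on setT (fun p => Pi p i j)) ->
  (forall p, (\rank (Pi p) <= k)%N) ->
  exists2 V, nbhs p0 V &
    exists K, forall L, (0 < L)%N -> (#|fixed_grid L Pi V| <= K * L ^ (d + k))%N.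
Proof.
move=> sPi rPi; have [c ac cp0] := atlas_cover p0.
have [r [f [B [rP fB]]]] := fixed_coordinates (Pi p0).
pose U := c @` (setT `&` chart_dom c).
have oU : open U by apply: open_chart_img; exact: openT.
have U0 : U (c p0) by exists p0.
pose F (ij : 'I_N * 'I_N) (x : 'rV[R]_d) := Pi (chart_inv c x) ij.1 ij.2.
have lipF ij : exists rL : R * R, [/\ 0 < rL.1, 0 <= rL.2, ball (c p0) rL.1 `<=` U &
    forall x y e, ball (c p0) rL.1 x -> ball (c p0) rL.1 y ->
      (forall i, `|x 0 i - y 0 i| <= e) -> `|F ij x - F ij y| <= rL.2 * e].
  have [r' [L' H]] := C1_locally_lipschitz oU U0 (sPi ij.1 ij.2 c ac 1%N).
  by exists (r', L').
have [rL {}lipF] := choice lipF.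
pose Lam := \sum_ij (rL ij).2.
have LamP ij : (rL ij).2 <= Lam.
  by rewrite /Lam (bigD1 ij) //= lerDl sumr_ge0 // => kl _; case: (lipF kl).
have Lam0 : 0 <= Lam by apply: sumr_ge0 => ij _; case: (lipF ij).
pose b := \sum_i \sum_j `|B i j|.
have bP i j : `|B i j| <= b.
  rewrite /b (bigD1 i) //= (bigD1 j) //= -addrA lerDl.
  by rewrite addr_ge0 ?sumr_ge0 // => i' _; rewrite sumr_ge0.
have b0 : 0 <= b by apply: sumr_ge0 => i _; apply: sumr_ge0.
pose N3b := N%:R ^+ 3 * b.
have N3b0 : 0 <= N3b by rewrite mulr_ge0 // exprn_ge0.
(* The radius s fits in all the Lipschitz balls, and [Lam * s], which bounds the entries of Pi p -
   Pi p0, meets the absorption condition of [fixed_rows_eq]. *)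
have [s [s0 sU sN]] : exists s, [/\ 0 < s, forall ij, s <= (rL ij).1 & N3b * (Lam * s) <= 2^-1].
  have : \forall s \near (0 : R)^'+, [/\ 0 < s, forall ij, s <= (rL ij).1 & N3b * (Lam * s) <= 2^-1].
    near=> s; split.
    - by near: s; exact: nbhs_right_gt.
    - near: s; apply: (@filter_forall _ _ (fun ij s => is_true (s <= (rL ij).1))) => ij.
      by apply: nbhs_right_le; case: (lipF ij).
    have : s <= (2 * (N3b * Lam + 1))^-1.
      near: s; apply: nbhs_right_le; rewrite invr_gt0 mulr_gt0 // ltr_wpDl //.
      exact: mulr_ge0.
    have : 0 < s by near: s; exact: nbhs_right_gt.
    have : 0 <= N3b * Lam by exact: mulr_ge0.
    rewrite mulrA; move: (N3b * Lam) => z z0 s0.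
    rewrite -[_^-1]mul1r ler_pdivlMr; last by rewrite mulr_gt0 // ltr_wpDl.
    by move=> H; rewrite -[2^-1]mul1r ler_pdivlMr //; lra.
  by move=> /filter_ex[s ?]; exists s.
have lip ij x y e : ball (c p0) s x -> ball (c p0) s y ->
      (forall i, `|x 0 i - y 0 i| <= e) -> 0 <= e -> `|F ij x - F ij y| <= Lam * e.
  move=> bx byy xy e0; have [_ _ _ H] := lipF ij.
  apply: (@le_trans _ _ ((rL ij).2 * e)); last by rewrite ler_wpM2r.
  by apply: H => //; [move: bx|move: byy]; apply: le_ball; exact: sU.
exists (chart_dom c `&` c @^-1` ball (c p0) s).
  apply: filterI; first by apply: open_nbhs_nbhs; split=> //; exact: chart_dom_open.
  by apply: (chart_map_cont cp0); exact: nbhsx_ballx.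
(* Cells of side e = 2 s / (m L) turn 2 N^3 b L Lam e into 4 N^3 b Lam s / m, which this m makes
   smaller than 1 for every L at once. *)
pose m := (Num.truncn (4 * N3b * Lam * s)).+1.
exists (m ^ d)%N => L L0.
have Q0 : (0 < m * L)%N by rewrite muln_gt0.
have [cell cellP] := cell_partition s0 Q0.
pose V := chart_dom c `&` c @^-1` ball (c p0) s.
have /choice[pt ptE] : forall g : {ffun 'I_N -> 'I_L}, exists p : M, g \in fixed_grid L Pi V ->
    [/\ chart_dom c p, ball (c p0) s (c p) & grid_row R g *m Pi p = grid_row R g].
  move=> g; have [|gV] := boolP (g \in fixed_grid L Pi V); last by exists p0.
  by move=> /fixed_gridP[p [cp bp] gp]; exists p.
(* A grid point is encoded by its coordinates along f and by the cell of its chosen point. There are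
   L^r (m L)^d codes, at most m^d L^(d + k) since r <= k. *)
pose Phi (g : {ffun 'I_N -> 'I_L}) := ([ffun a => g (f a)] : {ffun 'I_r -> 'I_L},
  [ffun i => cell (c (pt g) 0 i - c p0 0 i)] : {ffun 'I_d -> 'I_(m * L)}).
have inj : {in fixed_grid L Pi V &, injective Phi}.
  move=> g h gG hG [] /ffunP gh /ffunP cgh.
  have [cg bg fg] := ptE _ gG; have [ch bh fh] := ptE _ hG.
  have coordP x : ball (c p0) s x -> forall i, `|x 0 i - c p0 0 i| < s.
    by move=> [_ /(_ 0)] + i => /(_ i); rewrite -ball_normE /ball_ /= distrC.
  pose e := 2 * s / (m * L)%:R.
  have e0 : 0 <= e by rewrite divr_ge0 // mulr_ge0 // ltW.
  have cc i : `|c (pt g) 0 i - c (pt h) 0 i| <= e.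
    have -> : c (pt g) 0 i - c (pt h) 0 i =
      (c (pt g) 0 i - c p0 0 i) - (c (pt h) 0 i - c p0 0 i) by ring.
    by apply: cellP; [exact: coordP|exact: coordP|have := cgh i; rewrite !ffunE].
  have PiF p i j : chart_dom c p -> Pi p i j = F (i, j) (c p).
    by move=> cp; rewrite /F chart_mapK.
  apply: (@fixed_rows_eq R N (Pi p0) B r f b (Lam * s) (Lam * e) fB _ _ b0 bP _
     (Pi (pt g)) (Pi (pt h)) L g h) => //.
  - by rewrite mulr_ge0 // ltW.
  - by rewrite mulr_ge0.
  - have -> : 2 * N%:R ^+ 3 * b * L%:R * (Lam * e) = (4 * N3b * Lam * s) / m%:R.
      by rewrite /e /N3b natrM; field; rewrite !pnatr_eq0 -!lt0n L0.
    rewrite ltr_pdivrMr // mul1r; apply: truncnS_gt.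
  - move=> i j; rewrite !PiF //; apply: lip => //; last exact: ltW.
      exact: ballxx.
    by move=> l; apply: ltW; exact: coordP.
  - by move=> i j; rewrite !PiF //; exact: lip.
  - by move=> a; have := gh a; rewrite !ffunE.
have := leq_card_in Phi _ inj.
rewrite card_prod !card_ffun !card_ord => /leq_trans; apply.
rewrite expnMn mulnCA expnD leq_mul2l [(L ^ r * _)%N]mulnC leq_mul2l.
apply/orP; right; apply/orP; right.
by rewrite leq_pexp2l // (leq_trans rP).
Unshelve. all: by end_near.
Qed.

(** Compactness adds up the local bounds to K L^(d + k). If every row were fixed somewhere, all L^N
    grid points would be counted, which is too many for L = K + 1 because d + k < N. *)
Lemma generic_nonfixed N k (Pi : M -> 'M[R]_N) : compact [set: M] ->
  (forall i j, smooth_fun_on setT (fun p => Pi p i j)) ->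
  (forall p, (\rank (Pi p) <= k)%N) -> (d + k < N)%N ->
  exists w : 'rV[R]_N, forall p, w *m Pi p != w.
Proof.
move=> cM sPi rPi dkN.
have [K KP] : exists K, forall L, (0 < L)%N -> (#|fixed_grid L Pi setT| <= K * L ^ (d + k))%N.
  apply: (@compact_ind M (fun A => exists K, forall L, (0 < L)%N ->
      (#|fixed_grid L Pi A| <= K * L ^ (d + k))%N)) => //.
  - exists 0%N => L _; rewrite leqn0 cards_eq0; apply/eqP/setP => g.
    by rewrite finset.in_set0; apply/fixed_gridP => -[].
  - move=> A B AB [K KB]; exists K => L L0; apply: leq_trans (KB L L0).
    apply/subset_leq_card/fintype.subsetP => g /fixed_gridP[p /AB Bp gp].
    by apply/fixed_gridP; exists p.
  - move=> A B [K KA] [K' KB]; exists (K + K')%N => L L0; rewrite mulnDl.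
    apply: leq_trans (leq_add (KA L L0) (KB L L0)).
    rewrite -cardsUI (leq_trans _ (leq_addr _ _)) //.
    apply/subset_leq_card/fintype.subsetP => g /fixed_gridP[p [Ap|Bp] gp]; apply/finset.setUP.
      by left; apply/fixed_gridP; exists p.
    by right; apply/fixed_gridP; exists p.
  - by move=> p; exact: fixed_grid_local_le.
apply: contrapT => /forallNP H.
have := KP K.+1 isT.
have -> : fixed_grid K.+1 Pi setT = finset.setT.
  apply/setP => g; rewrite finset.in_setT; apply/fixed_gridP.
  have := H (grid_row R g) => /existsNP[p /negP]; rewrite negbK => /eqP ?.
  by exists p.
rewrite cardsT card_ffun !card_ord leqNgt => /negP; apply.
apply: (@leq_trans (K.+1 ^ (d + k).+1)%N); last by rewrite leq_pexp2l.
by rewrite expnS ltn_mul2r expn_gt0 ltnSn.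
Qed.

End GenericVector.

(** * Smooth sections of a Hermitian bundle *)

Section ComplexSmoothFunctions.
Context (R : realType) (d : nat) (M : smoothManifold R d).
Local Notation C := (R[i]).
Implicit Types (U V : set M) (f g : M -> C).

Lemma csmooth_fun_on_sub U V f : V `<=` U -> csmooth_fun_on U f -> csmooth_fun_on V f.
Proof. by move=> VU [fr fi]; split; exact: smooth_fun_on_sub VU _. Qed.

Lemma csmooth_fun_on_bigcup (I : Type) (U : I -> set M) f :
  (forall i, csmooth_fun_on (U i) f) -> csmooth_fun_on (\bigcup_i U i) f.
Proof. by move=> sf; split; apply: smooth_fun_on_bigcup => i; case: (sf i). Qed.

Lemma csmooth_fun_onD U f g : open U ->
  csmooth_fun_on U f -> csmooth_fun_on U g -> csmooth_fun_on U (fun p => f p + g p).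
Proof.
move=> oU [fr fi] [gr gi]; split.
  by under eq_fun do rewrite raddfD; exact: (smooth_fun_onD oU fr gr).
by under eq_fun do rewrite raddfD; exact: (smooth_fun_onD oU fi gi).
Qed.

Lemma csmooth_fun_onM U f g : open U ->
  csmooth_fun_on U f -> csmooth_fun_on U g -> csmooth_fun_on U (fun p => f p * g p).
Proof.
move=> oU [fr fi] [gr gi]; split.
  have E (x y : C) : complex.Re (x * y) =
      complex.Re x * complex.Re y + - (complex.Im x * complex.Im y) by case: x; case: y.
  under eq_fun do rewrite E.
  exact: (smooth_fun_onD oU (smooth_fun_onM oU fr gr)
    (smooth_fun_onN oU (smooth_fun_onM oU fi gi))).
have E (x y : C) : complex.Im (x * y) =
    complex.Re x * complex.Im y + complex.Im x * complex.Re y by case: x; case: y.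
under eq_fun do rewrite E.
exact: (smooth_fun_onD oU (smooth_fun_onM oU fr gi) (smooth_fun_onM oU fi gr)).
Qed.

Lemma csmooth_fun_on_conj U f : open U ->
  csmooth_fun_on U f -> csmooth_fun_on U (fun p => (f p)^*).
Proof.
move=> oU [fr fi]; split.
  have E (x : C) : complex.Re x^* = complex.Re x by case: x.
  by under eq_fun do rewrite E.
have E (x : C) : complex.Im x^* = - complex.Im x by case: x.
by under eq_fun do rewrite E; exact: (smooth_fun_onN oU fi).
Qed.

Lemma csmooth_fun_on_real U (f : M -> R) :
  smooth_fun_on U f -> csmooth_fun_on U (fun p => (f p)%:C%C).
Proof. by move=> sf; split => //; exact: smooth_fun_on_cst. Qed.

Lemma csmooth_fun_on_sum U (I : Type) (r : seq I) (P : pred I) (F : I -> M -> C) : open U ->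
  (forall i, P i -> csmooth_fun_on U (F i)) ->
  csmooth_fun_on U (fun p => \sum_(i <- r | P i) F i p).
Proof.
move=> oU sF; elim: r => [|i r IH].
  by under eq_fun do rewrite big_nil; exact: csmooth_fun_on_cst.
case Pi: (P i); last by under eq_fun do rewrite big_cons Pi.
by under eq_fun do rewrite big_cons Pi; exact: (csmooth_fun_onD oU (sF i Pi) IH).
Qed.

End ComplexSmoothFunctions.

Section Sections.
Context (R : realType) (d : nat) (M : smoothManifold R d).
Context (k : nat) (E : complexBundle M k) (h : hermitianStructure E).
Local Notation C := (R[i]).
Implicit Types (U V : set M) (s u : forall p, E p).

(** Localizing smoothness to U allows sections to be built locally and glued over open covers. *)
Definition section_on U s := forall t, trivs t -> forall j,
  csmooth_fun_on (U `&` triv_dom t) (fun p => t p (s p) 0 j).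

Lemma section_onT s : section_on setT s -> smooth_section s.
Proof. by move=> ss t Et j; have := ss t Et j; rewrite setTI. Qed.

Lemma section_onU U V s : section_on U s -> section_on V s -> section_on (U `|` V) s.
Proof.
move=> sU sV t Et j; rewrite setIUl.
apply: (@csmooth_fun_on_sub _ _ _
  (\bigcup_(b : bool) if b then U `&` triv_dom t else V `&` triv_dom t)).
  by move=> p [Up|Vp]; [exists true|exists false].
by apply: csmooth_fun_on_bigcup => -[]; [exact: sU|exact: sV].
Qed.

Lemma openI_triv U (t : localTriv E k) : open U -> open (U `&` triv_dom t).
Proof. by move=> oU; apply: openI => //; exact: triv_dom_open. Qed.

Lemma section_on_eq U s u : open U -> (forall p, U p -> s p = u p) ->
  section_on U s -> section_on U u.
Proof.
move=> oU su ss t Et j; apply: csmooth_fun_on_eq (ss t Et j); first exact: openI_triv.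
by move=> p [/su ->].
Qed.

Lemma section_on0 U : section_on U (fun p => 0).
Proof.
move=> t Et j; under eq_fun do rewrite linear0 mxE; exact: csmooth_fun_on_cst.
Qed.

Lemma section_onD U s u : open U -> section_on U s -> section_on U u ->
  section_on U (fun p => s p + u p).
Proof.
move=> oU ss su t Et j; under eq_fun do rewrite linearD mxE.
exact: (csmooth_fun_onD (openI_triv t oU) (ss t Et j) (su t Et j)).
Qed.

Lemma section_onZ U (f : M -> C) s : open U -> csmooth_fun_on U f -> section_on U s ->
  section_on U (fun p => f p *: s p).
Proof.
move=> oU sf ss t Et j; under eq_fun do rewrite linearZ mxE.
have sf' : csmooth_fun_on (U `&` triv_dom t) f by apply: csmooth_fun_on_sub sf => p [].
exact: (csmooth_fun_onM (openI_triv t oU) sf' (ss t Et j)).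
Qed.

Lemma section_on_sum U (I : Type) (r : seq I) (P : pred I) (F : I -> forall p, E p) :
  open U -> (forall i, P i -> section_on U (F i)) ->
  section_on U (fun p => \sum_(i <- r | P i) F i p).
Proof.
move=> oU sF t Et j; under eq_fun do rewrite linear_sum summxE.
by apply: csmooth_fun_on_sum => [|i Pi]; [exact: openI_triv|exact: sF].
Qed.

Lemma triv_local_frame (t : localTriv E k) i p : triv_dom t p ->
  t p (local_frame t i p) = delta_mx 0 i.
Proof. by move=> /localTriv_inv[_ tVK]; rewrite /local_frame tVK. Qed.

Lemma section_on_local_frame (t : localTriv E k) i : trivs t ->
  section_on (triv_dom t) (local_frame t i).
Proof. by move=> Et t' Et' j; exact: trivs_compatible. Qed.

Lemma local_frame_sum (t : localTriv E k) p (v : E p) : triv_dom t p ->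
  v = \sum_i t p v 0 i *: local_frame t i p.
Proof.
move=> /localTriv_inv[tK _]; rewrite -[LHS]tK {1}[t p v]row_sum_delta linear_sum.
by apply: eq_bigr => i _; rewrite linearZ.
Qed.

Section Fibre.
Variable p : M.
Implicit Types (v w x : E p).

Lemma hform_conj v w : h p v w = (h p w v)^*.
Proof. by rewrite hermC expr0 mul1r. Qed.

Lemma hformDl v w x : h p (v + w) x = h p v x + h p w x.
Proof. exact: linearDl. Qed.

Lemma hformDr v w x : h p x (v + w) = h p x v + h p x w.
Proof. exact: linearDr. Qed.

Lemma hformZl a v x : h p (a *: v) x = a * h p v x.
Proof. exact: linearZl_LR. Qed.

Lemma hformZr a v x : h p x (a *: v) = a^* * h p x v.
Proof. exact: linearZr_LR. Qed.

Lemma hform0r v : h p v 0 = 0.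
Proof. exact: linear0r. Qed.

Lemma hform_suml (I : Type) (r : seq I) (P : pred I) (F : I -> E p) x :
  h p (\sum_(i <- r | P i) F i) x = \sum_(i <- r | P i) h p (F i) x.
Proof. exact: linear_sumlz. Qed.

Lemma hform_sumr (I : Type) (r : seq I) (P : pred I) (F : I -> E p) x :
  h p x (\sum_(i <- r | P i) F i) = \sum_(i <- r | P i) h p x (F i).
Proof. exact: linear_sumr. Qed.

Lemma hform_gt0 v : v != 0 -> 0 < h p v v.
Proof. exact: neq0_dnorm_gt0. Qed.

Lemma hform_ge0 v : 0 <= h p v v.
Proof. exact: dnorm_ge0. Qed.

End Fibre.

(** Over a trivialization the form expands into the coordinates of s and u and the Gram matrix of
    the local frame, all of which are smooth. *)
Lemma csmooth_hform U s u : open U -> section_on U s -> section_on U u ->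
  csmooth_fun_on U (fun p => h p (s p) (u p)).
Proof.
move=> oU ss su.
apply: (@csmooth_fun_on_sub _ _ _
    (\bigcup_(t : {t : localTriv E k | trivs t}) (U `&` triv_dom (sval t)))).
  by move=> p Up; have [t Et tp] := trivs_cover E p; exists (exist _ t Et).
apply: csmooth_fun_on_bigcup => -[t Et] /=.
have oUt := openI_triv t oU.
apply: (@csmooth_fun_on_eq _ _ _ _ (fun p => \sum_i \sum_j
  t p (s p) 0 i * ((t p (u p) 0 j)^* * h p (local_frame t i p) (local_frame t j p)))) => //.
  move=> p [Up tp]; rewrite [s p in RHS](local_frame_sum _ tp) hform_suml.
  apply: eq_bigr => i _; rewrite hformZl [u p in RHS](local_frame_sum _ tp) hform_sumr.
  by rewrite mulr_sumr; apply: eq_bigr => j _; rewrite hformZr.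
apply: csmooth_fun_on_sum => // i _; apply: csmooth_fun_on_sum => // j _.
have sh : csmooth_fun_on (U `&` triv_dom t)
    (fun p => h p (local_frame t i p) (local_frame t j p)).
  by apply: csmooth_fun_on_sub (hform_smooth h Et i j) => p [].
exact: (csmooth_fun_onM oUt (ss t Et i)
  (csmooth_fun_onM oUt (csmooth_fun_on_conj oUt (su t Et j)) sh)).
Qed.

End Sections.

(** * Smooth Gram-Schmidt orthonormalization of local frames *)

Section LocalOrthonormalFrames.
Context (R : realType) (d : nat) (M : smoothManifold R d).
Context (k : nat) (E : complexBundle M k) (h : hermitianStructure E).
Local Notation C := (R[i]).

Lemma real_of_nonneg (z : C) : 0 <= z -> z = (complex.Re z)%:C%C.
Proof. by case: z => a b; rewrite lecE /= => /andP[/eqP -> _]. Qed.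

Lemma conj_real (a : R) : (a%:C%C : C)^* = a%:C%C.
Proof. exact: conjc_real. Qed.

Lemma Re_hform_gt0 p (v : E p) : v != 0 -> 0 < complex.Re (h p v v).
Proof. by move=> v0; rewrite -ltcR -real_of_nonneg ?hform_gt0 ?hform_ge0. Qed.

(* The condition that u_i has no component along e_j for j >= m is what makes the
   next Gram-Schmidt residue nonzero. *)
Lemma gram_schmidt (t : localTriv E k) (m : nat) : trivs t -> (m <= k)%N ->
  exists u : 'I_k -> forall p, E p,
  [/\ forall i : 'I_k, (i < m)%N -> section_on (triv_dom t) (u i),
      forall p (i j : 'I_k), triv_dom t p -> (i < m)%N -> (j < m)%N ->
        h p (u i p) (u j p) = (i == j)%:R,
      forall p (i j : 'I_k), triv_dom t p -> (i < m)%N -> (m <= j)%N ->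
        t p (u i p) 0 j = 0 &
      forall p (j : 'I_k), triv_dom t p -> (j < m)%N ->
        local_frame t j p =
          \sum_(i < k | (i < m)%N) h p (local_frame t j p) (u i p) *: u i p].
Proof.
move=> Et; have oU := @triv_dom_open _ _ _ _ _ t.
elim: m => [_|m IH mk]; first by exists (local_frame t); split.
have [u [su hu tu eu]] := IH (ltnW mk).
pose i0 := Ordinal mk; pose e := local_frame t i0.
pose r p : E p := e p + \sum_(i < k | (i < m)%N) (- h p (e p) (u i p)) *: u i p.
have se : section_on (triv_dom t) e by exact: section_on_local_frame.
have sr : section_on (triv_dom t) r.
  apply: section_onD => //; apply: section_on_sum => // i im.
  apply: section_onZ => //; last exact: su.
  under eq_fun do rewrite -mulN1r.
  exact: (csmooth_fun_onM oU (csmooth_fun_on_cst _ _) (csmooth_hform h oU se (su i im))).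
(* The coordinate of r at [i0] is that of e, namely 1, since no u_i with i < m has a component
   there. *)
have r0 p : triv_dom t p -> r p != 0.
  move=> tp; apply/eqP => /(congr1 (fun v => t p v 0 i0)).
  rewrite /= linear0 [RHS]mxE /r linearD /= [LHS]mxE /e triv_local_frame // mxE !eqxx.
  rewrite linear_sum /= summxE big1 ?addr0.
    by move/eqP; rewrite oner_eq0.
  by move=> i im; rewrite linearZ /= mxE tu // mulr0.
have ru p (i : 'I_k) : triv_dom t p -> (i < m)%N -> h p (r p) (u i p) = 0.
  move=> tp im; rewrite hformDl hform_suml (bigD1 i) //= hformZl hu // eqxx mulr1.
  rewrite big1 ?addr0 ?subrr // => j /andP[jm ji].
  by rewrite hformZl hu // (negPf ji) mulr0.
(* This is 1 / |r|, written as a real power of a positive smooth function. *)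
pose nu p : C := ((complex.Re (h p (r p) (r p))) `^ (- 2^-1))%:C%C.
have snu : csmooth_fun_on (triv_dom t) nu.
  apply: csmooth_fun_on_real; apply: smooth_fun_on_powR => //.
    by move=> p /r0; exact: Re_hform_gt0.
  by case: (csmooth_hform h oU sr sr).
have nuE p : triv_dom t p -> [/\ nu p * nu p * h p (r p) (r p) = 1 & (nu p)^* = nu p].
  move=> tp; split; last exact: conj_real.
  have := Re_hform_gt0 (r0 p tp).
  rewrite [in X in _ -> X](real_of_nonneg (hform_ge0 h (r p))) /nu.
  move: (complex.Re _) => x x0; rewrite -!rmorphM -powRD; last by rewrite (gt_eqF x0) implybT.
  rewrite -opprD -mulr2n -[2^-1 *+ 2]mulr_natl mulfV // powRN powRr1 ?ltW // mulVf ?gt_eqF //.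
pose um p : E p := nu p *: r p.
exists (fun i => if i == i0 then um else u i).
have lt_m (i : 'I_k) : i != i0 -> (i < m.+1)%N = (i < m)%N.
  by move=> ii0; rewrite ltnS leq_eqVlt -(inj_eq val_inj) /= in ii0 *; rewrite (negPf ii0).
have lt_i0 (i : 'I_k) : (i < m)%N -> i != i0.
  by move=> im; apply/eqP => E0; rewrite E0 ltnn in im.
split.
- move=> i im; case: eqP => [_|/eqP ii0]; first exact: section_onZ.
  by apply: su; rewrite -lt_m.
- move=> p i j tp im jm; have [nn nc] := nuE p tp.
  case: (eqVneq i i0) im => [->|ii0] im; case: (eqVneq j i0) jm => [->|jj0] jm.
  + by rewrite hformZl hformZr nc mulrA nn.
  + by rewrite hformZl ru ?mulr0 // -lt_m.
  + by rewrite (negPf ii0) hformZr hform_conj ru ?conjC0 ?mulr0 // -lt_m.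
  + by rewrite hu // -lt_m.
- move=> p i j tp im mj; case: eqP im => [->|/eqP ii0] im.
    rewrite linearZ /= mxE linearD /= mxE /e triv_local_frame // mxE eqxx /= -val_eqE /= gtn_eqF //.
    rewrite add0r linear_sum /= summxE big1 ?mulr0 // => l lm.
    by rewrite linearZ /= mxE tu ?mulr0 // ltnW.
  by rewrite (tu p i j tp _ (ltnW mj)) // -lt_m.
- move=> p j tp jm.
  have splitE (w : E p) : \sum_(i < k | (i < m.+1)%N)
        h p w ((if i == i0 then um else u i) p) *: (if i == i0 then um else u i) p =
      h p w (um p) *: um p + \sum_(i < k | (i < m)%N) h p w (u i p) *: u i p.
    rewrite [LHS](bigD1 i0 (ltnSn m)) eqxx; congr (_ + _).
    apply: eq_big => [i|i /andP[_ ii0]]; last by rewrite (negPf ii0).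
    have [->|ii0] := eqVneq i i0; first by rewrite andbF ltnn.
    by rewrite andbT lt_m.
  rewrite splitE.
  have [nn nc] := nuE p tp.
  case: (eqVneq j i0) jm => [->|jj0] jm.
    (* For the new index, e - r is a combination of the earlier u_i, which are orthogonal to r, so
       only r contributes to the coefficient. *)
    have er : e p = r p + \sum_(i < k | (i < m)%N) h p (e p) (u i p) *: u i p.
      rewrite /r -addrA -big_split big1 ?addr0 // => i _.
      by rewrite /= -scalerDl addNr scale0r.
    have -> : h p (local_frame t i0 p) (um p) = nu p * h p (r p) (r p).
      rewrite hformZr nc -/(e p) {1}er hformDl hform_suml big1 ?addr0 // => i im.
      by rewrite hformZl (hform_conj h (u i p)) ru // conjC0 mulr0.
    by rewrite /um scalerA mulrAC nn scale1r.
  (* An earlier frame vector lies in the span of the u_i with i < m, hence is orthogonal to the new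
     vector. *)
  rewrite lt_m // in jm; rewrite [LHS](eu p j tp jm).
  rewrite [X in X *: um p + _](_ : _ = 0) ?scale0r ?add0r //.
  rewrite (eu p j tp jm) hform_suml big1 // => i im.
  by rewrite hformZl hformZr (hform_conj h (u i p)) ru // conjC0 !mulr0.
Qed.

(** For m = k the expansions of the frame vectors extend linearly to v = sum_i <v, u_i> u_i; pairing
    with v gives the identity. *)
Lemma local_orthonormal_frame (t : localTriv E k) : trivs t ->
  exists u : 'I_k -> forall p, E p, (forall i, section_on (triv_dom t) (u i)) /\
    forall p v, triv_dom t p -> \sum_i `|h p v (u i p)| ^+ 2 = h p v v.
Proof.
move=> Et; have [u [su hu _ eu]] := gram_schmidt Et (leqnn k).
exists u; split=> [i|p v tp]; first exact: su.
have vE : v = \sum_i h p v (u i p) *: u i p.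
  rewrite {1}(local_frame_sum v tp).
  under eq_bigr => j _ do rewrite (eu p j tp (ltn_ord j)) scaler_sumr.
  rewrite exchange_big /=; apply: eq_big => [i|i _]; first by rewrite ltn_ord.
  rewrite {2}(local_frame_sum v tp) hform_suml scaler_suml.
  by apply: eq_bigr => j _; rewrite hformZl scalerA.
rewrite {3}vE hform_sumr; apply: eq_bigr => i _.
by rewrite hformZr normCK mulrC.
Qed.

End LocalOrthonormalFrames.

(** * Parseval frames of arbitrary size *)

Section InitialFrame.
Context (R : realType) (d : nat) (M : smoothManifold R d).
Context (k : nat) (E : complexBundle M k) (h : hermitianStructure E).
Local Notation C := (R[i]).

(** The frame operator is b times the identity, with b allowed to vanish off A. This form is stable
    under unions of the sets A, so [compact_ind] applies, and normalization waits until b is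
    positive everywhere. *)
Definition weighted_frame (A : set M) : Prop :=
  exists (N : nat) (f : 'I_N -> forall p, E p) (b : M -> R),
  [/\ forall i, section_on setT (f i), smooth_fun_on setT b, forall p, 0 <= b p,
      forall p, A p -> 0 < b p &
      forall p v, \sum_i `|h p v (f i p)| ^+ 2 = (b p)%:C%C * h p v v].

(** A local orthonormal frame multiplied by a bump b extends by 0 to all of M and has weight b^2. *)
Lemma weighted_frame_local (p0 : M) : exists2 V, nbhs p0 V & weighted_frame V.
Proof.
have [t Et tp0] := trivs_cover E p0.
have oU := @triv_dom_open _ _ _ _ _ t.
have [u [su uP]] := local_orthonormal_frame h Et.
have [b [sb b0 bV [K cK [KU bK]]]] := smooth_bump oU tp0.
exists [set p | 0 < b p] => //.
exists k, (fun i p => (b p)%:C%C *: u i p), (fun p => b p * b p); split.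
- move=> i; rewrite (_ : setT = triv_dom t `|` ~` K); last first.
    by apply/seteqP; split=> p // _; have [/KU ?|?] := pselect (K p); [left|right].
  apply: section_onU.
    apply: section_onZ => //; apply: csmooth_fun_on_real.
    exact: smooth_fun_on_sub sb.
  apply: (@section_on_eq _ _ _ _ _ _ (fun p => 0)); first exact: closed_openC.
    by move=> p /bK ->; rewrite scale0r.
  exact: section_on0.
- by apply: smooth_fun_onM => //; exact: openT.
- by move=> p; rewrite mulr_ge0.
- by move=> p /= bp; rewrite mulr_gt0.
move=> p v; have [tp|ntp] := pselect (triv_dom t p).
  rewrite -(uP p v tp) mulr_sumr; apply: eq_bigr => i _.
  rewrite hformZr conj_real normrM exprMn; congr (_ * _).
  by rewrite normCK conj_real rmorphM.
rewrite bK; last by move=> /KU.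
rewrite mulr0 mul0r big1 // => i _.
by rewrite scale0r hform0r normr0 expr0n.
Qed.

(** Concatenating two families adds their weights. *)
Lemma weighted_frameU A B : weighted_frame A -> weighted_frame B ->
  weighted_frame (A `|` B).
Proof.
move=> [N [f [b [sf sb b0 bA fP]]]] [N' [f' [b' [sf' sb' b0' bB fP']]]].
exists (N + N')%N, (fun i => match fintype.split i with inl i => f i | inr i => f' i end),
  (fun p => b p + b' p); split.
- by move=> i; case: (fintype.split i).
- by apply: smooth_fun_onD => //; exact: openT.
- by move=> p; rewrite addr_ge0.
- by move=> p [/bA|/bB] ?; [rewrite ltr_pwDl|rewrite ltr_wpDl].
move=> p v; rewrite big_split_ord /= rmorphD mulrDl -fP -fP'.
congr (_ + _); apply: eq_bigr => i _.
  by rewrite -[lshift _ i]/(unsplit (inl i)) unsplitK.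
by rewrite -[rshift _ i]/(unsplit (inr i)) unsplitK.
Qed.

(** A weighted frame over all of M has a positive weight b, and scaling it by b^(-1/2) normalizes
    it. *)
Lemma exists_parseval_frame : compact [set: M] ->
  exists N (f : 'I_N -> forall p, E p), parseval_frame h f.
Proof.
move=> cM; have [N [f [b [sf sb _ bT fP]]]] : weighted_frame setT.
  apply: (@compact_ind M) => //.
  - exists 0%N, (fun _ p => 0), (fun=> 0); split=> //.
    + by case.
    + exact: smooth_fun_on_cst.
    + by move=> p v; rewrite big_ord0 mul0r.
  - move=> A B AB [N [f [b [sf sb b0 bA fP]]]].
    by exists N, f, b; split=> // p /AB/bA.
  - exact: weighted_frameU.
  - exact: weighted_frame_local.
have oT := @openT M.
have bT' p : [set: M] p -> 0 < b p by exact: bT.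
exists N, (fun i p => ((b p) `^ (- 2^-1))%:C%C *: f i p); split=> [i|p v].
  apply/section_onT/section_onZ => //; apply: csmooth_fun_on_real.
  exact: smooth_fun_on_powR.
transitivity ((((b p) `^ (- 2^-1))%:C%C ^+ 2) * (b p)%:C%C * h p v v).
  rewrite -mulrA -fP mulr_sumr; apply: eq_bigr => i _.
  by rewrite hformZr conj_real normrM exprMn normCK conj_real.
rewrite -rmorphXn -rmorphM -[RHS]mul1r; congr (_ * _).
rewrite -powR_mulrn ?powR_ge0 // -powRrM mulNr mulVf // powRN powRr1 ?ltW ?bT //.
by rewrite mulVf // gt_eqF ?bT.
Qed.

Lemma parseval_frame_pad N m (f : 'I_N -> forall p, E p) : parseval_frame h f ->
  exists g : 'I_(N + m) -> forall p, E p, parseval_frame h g.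
Proof.
move=> [sf fP]; exists (fun i => match fintype.split i with inl i => f i | inr _ => fun p => 0 end).
split=> [i|p v].
  by case: (fintype.split i) => // _; apply/section_onT/section_on0.
rewrite -fP big_split_ord /= [X in _ + X]big1 ?addr0 => [|i _].
  by apply: eq_bigr => i _; rewrite -[lshift _ i]/(unsplit (inl i)) unsplitK.
by rewrite -[rshift _ i]/(unsplit (inr i)) unsplitK hform0r normr0 expr0n.
Qed.

End InitialFrame.

(** * Deleting a vector from a Parseval frame *)

Section Realification.
Context (R : realType).
Local Notation C := (R[i]).

(* Acting on the right on rows (Re w, Im w). *)
Definition realify m n (A : 'M[C]_(m, n)) : 'M[R]_(m + m, n + n) :=
  block_mx (map_mx (@complex.Re R) A) (map_mx (@complex.Im R) A)
           (- map_mx (@complex.Im R) A) (map_mx (@complex.Re R) A).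

Lemma Re_mulmx m n p (A : 'M[C]_(m, n)) (B : 'M[C]_(n, p)) :
  map_mx (@complex.Re R) (A *m B) =
  map_mx (@complex.Re R) A *m map_mx (@complex.Re R) B -
  map_mx (@complex.Im R) A *m map_mx (@complex.Im R) B.
Proof.
apply/matrixP => i j; rewrite !mxE raddf_sum -sumrB; apply: eq_bigr => l _.
by rewrite !mxE; case: (A i l) => a b; case: (B l j).
Qed.

Lemma Im_mulmx m n p (A : 'M[C]_(m, n)) (B : 'M[C]_(n, p)) :
  map_mx (@complex.Im R) (A *m B) =
  map_mx (@complex.Re R) A *m map_mx (@complex.Im R) B +
  map_mx (@complex.Im R) A *m map_mx (@complex.Re R) B.
Proof.
apply/matrixP => i j; rewrite !mxE raddf_sum -big_split; apply: eq_bigr => l _.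
by rewrite !mxE; case: (A i l) => a b; case: (B l j).
Qed.

Lemma realify_mul m n p (A : 'M[C]_(m, n)) (B : 'M[C]_(n, p)) :
  realify (A *m B) = realify A *m realify B.
Proof.
rewrite /realify mulmx_block Re_mulmx Im_mulmx !mulmxN !mulNmx; congr block_mx.
- by rewrite opprD addrC.
- by rewrite addrC.
Qed.

Lemma row_realify_mul n (w : 'rV[C]_n) (A : 'M[C]_n) :
  row_mx (map_mx (@complex.Re R) w) (map_mx (@complex.Im R) w) *m realify A =
  row_mx (map_mx (@complex.Re R) (w *m A)) (map_mx (@complex.Im R) (w *m A)).
Proof. by rewrite mul_row_block Re_mulmx Im_mulmx mulmxN. Qed.

Context (d : nat) (M : smoothManifold R d).

(** A factorization through C^k bounds the real rank of the realification by 2k, so the real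
    statement applies in dimension 2N. *)
Lemma generic_nonfixed_complex N k (Pi : M -> 'M[C]_N) : compact [set: M] ->
  (forall i j, csmooth_fun_on setT (fun p => Pi p i j)) ->
  (forall p, exists (A : 'M[C]_(N, k)) (B : 'M[C]_(k, N)), Pi p = A *m B) ->
  (d./2 + k < N)%N ->
  exists w : 'rV[C]_N, forall p, w *m Pi p != w.
Proof.
move=> cM sPi rPi dkN.
have [|p||w wP] := @generic_nonfixed R d M (N + N) (k + k) (fun p => realify (Pi p)) cM.
- have oT := @openT M.
  move=> i j; rewrite /realify; case: (split_ordP i) => i' ->; case: (split_ordP j) => j' ->.
  + by under eq_fun do rewrite block_mxEul mxE; case: (sPi i' j').
  + by under eq_fun do rewrite block_mxEur mxE; case: (sPi i' j').
  + under eq_fun do rewrite block_mxEdl !mxE.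
    by case: (sPi i' j') => _ sI; exact: (smooth_fun_onN oT sI).
  + by under eq_fun do rewrite block_mxEdr mxE; case: (sPi i' j').
- have [A [B ->]] := rPi p; rewrite realify_mul.
  exact: leq_trans (mxrankM_maxl _ _) (rank_leq_col _).
(* From d <= 2 floor(d/2) + 1 and floor(d/2) + k < N follows d + 2k < 2N. *)
- by have := odd_double_half d; case: (odd d) => /= dE; lia.
exists (\row_j (lsubmx w 0 j +i* rsubmx w 0 j)%C) => p; apply: contra (wP p) => /eqP wE.
have wr : w = row_mx (map_mx (@complex.Re R) (\row_j (lsubmx w 0 j +i* rsubmx w 0 j)%C))
             (map_mx (@complex.Im R) (\row_j (lsubmx w 0 j +i* rsubmx w 0 j)%C)).
  rewrite -[LHS]hsubmxK; congr row_mx; apply/rowP => j; by rewrite !mxE.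
by rewrite {1}wr row_realify_mul wE -wr.
Qed.

End Realification.

(** * Rotating a frame by a constant unitary matrix *)

Section Reduction.
Context (R : realType) (d : nat) (M : smoothManifold R d).
Context (k : nat) (E : complexBundle M k) (h : hermitianStructure E).
Local Notation C := (R[i]).
Local Open Scope sesquilinear_scope.

Lemma dotmx_sum n (u v : 'rV[C]_n) : dotmx u v = \sum_j u 0 j * (v 0 j)^*.
Proof. by rewrite dotmxE mxE; apply: eq_bigr => j _; rewrite !mxE. Qed.

(** Gram-Schmidt is applied to the matrix whose rows all equal w. Stating the result as an inclusion
    of row spaces covers w = 0 and avoids normalizing w. *)
Lemma unitary_first_row n (w : 'rV[C]_n.+1) :
  exists2 S : 'M[C]_n.+1, S \is unitarymx & (w <= row 0 S)%MS.
Proof.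
exists (schmidt (\matrix_(i < n.+1) w)); first exact: schmidt_unitarymx.
have := row_schmidt_sub (\matrix_(i < n.+1) w) 0.
rewrite rowK (big_pred1 (0 : 'I_n.+1)) ?genmxE // => i.
by apply/idP/eqP => [|-> //]; rewrite leqn0 => /eqP ?; exact: val_inj.
Qed.

(** The coefficient row x of v becomes x S^*, which has the same norm because S is unitary. *)
Lemma rotated_parseval N (f : 'I_N -> forall p, E p) (S : 'M[C]_N) :
  S \is unitarymx -> parseval_frame h f ->
  parseval_frame h (fun i p => \sum_j S i j *: f j p).
Proof.
move=> uS [sf fP]; have oT := @openT M.
have sf' j : section_on setT (f j).
  by move=> t Et l; rewrite setTI; exact: sf.
split=> [i|p v].
  apply: section_onT; apply: section_on_sum => // j _.
  apply: section_onZ => //; exact: csmooth_fun_on_cst.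
rewrite -fP; pose x : 'rV[C]_N := \row_j h p v (f j p).
transitivity (dotmx (x *m S^t*) (x *m S^t*)).
  rewrite dotmx_sum; apply: eq_bigr => i _; rewrite -normCK; congr (`|_| ^+ 2).
  rewrite hform_sumr mxE; apply: eq_bigr => j _.
  by rewrite hformZr !mxE mulrC.
transitivity (dotmx x x).
  rewrite !dotmxE; congr (_ 0 0).
  by rewrite trmx_mul map_mxM trmxCK mulmxA mulmxKtV.
by rewrite dotmx_sum; apply: eq_bigr => j _; rewrite mxE normCK.
Qed.

(** With Pi the Gram matrix and g the combination, the Parseval identity gives |z Pi|^2 = <z, z Pi>
    = |g|^2, so that 0 < |z - z Pi|^2 = 1 - |g|^2. *)
Lemma parseval_combination_lt N (f : 'I_N -> forall p, E p) p (z : 'rV[C]_N) :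
  parseval_frame h f -> dotmx z z = 1 ->
  z *m (\matrix_(i, j) h p (f i p) (f j p)) != z ->
  h p (\sum_j z 0 j *: f j p) (\sum_j z 0 j *: f j p) < 1.
Proof.
move=> [_ fP] z1 zP; set g := \sum_j _; set Pi := \matrix_(i, j) _ in zP.
have xE j : (z *m Pi) 0 j = h p g (f j p).
  by rewrite mxE hform_suml; apply: eq_bigr => i _; rewrite mxE hformZl.
have zx : dotmx z (z *m Pi) = h p g g.
  rewrite dotmx_sum {1}/g hform_suml; apply: eq_bigr => j _.
  by rewrite xE hformZl -hform_conj.
have xx : dotmx (z *m Pi) (z *m Pi) = h p g g.
  by rewrite -fP dotmx_sum; apply: eq_bigr => j _; rewrite xE normCK.
have xz : dotmx (z *m Pi) z = h p g g.
  rewrite [RHS]hform_conj -zx !dotmx_sum rmorph_sum; apply: eq_bigr => j _.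
  by rewrite rmorphM /= conjCK mulrC.
have : 0 < dotmx (z - z *m Pi) (z - z *m Pi).
  by rewrite dnorm_gt0 subr_eq0 eq_sym.
by rewrite linearBl !linearBr /= z1 zx xz xx subrr subr0 subr_gt0.
Qed.

End Reduction.

(** * Removing the first vector when its norm is smaller than 1 *)

Section DropVector.
Context (R : realType) (d : nat) (M : smoothManifold R d).
Context (k : nat) (E : complexBundle M k) (h : hermitianStructure E).
Local Notation C := (R[i]).

(* I + c g g^* is the inverse square root of I - g g^* for c = 1 / (s (1 + s)),
   where a = |g|^2 and s = sqrt (1 - a); this form of c stays smooth at g = 0. *)
Definition shrink_coef (a : R) : R :=
  (1 - a) `^ (- 2^-1) * (1 + (1 - a) `^ 2^-1) `^ (- 1).

(** Both sides equal 1 / (1 - a). For T = I + c g g^* and a = |g|^2 the identity says |T v|^2 - |<T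
    v, g>|^2 = |v|^2. *)
Lemma shrink_coefP (a : R) : a < 1 ->
  2 * shrink_coef a + shrink_coef a ^+ 2 * a = (1 + shrink_coef a * a) ^+ 2.
Proof.
move=> a1; rewrite /shrink_coef.
have x0 : 0 < 1 - a by rewrite subr_gt0.
rewrite powRN; set s := (1 - a) `^ 2^-1.
have s0 : 0 < s by exact: powR_gt0.
have aE : a = 1 - s ^+ 2.
  rewrite /s -powR_mulrn ?powR_ge0 // -powRrM mulVf // powRr1 ?ltW //; ring.
rewrite powRN powRr1 ?addr_ge0 // ?ltW //.
rewrite [in LHS]aE [in RHS]aE; field.
by rewrite !gt_eqF // addr_gt0.
Qed.

(** As T = I + c g g^* is self-adjoint, the coefficients of v against the T f_i are those of T v
    against the f_i. The Parseval identity at T v, minus its first term, then reduces to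
    [shrink_coefP]. *)
Lemma parseval_drop_first N (f : 'I_N.+1 -> forall p, E p) :
  parseval_frame h f -> (forall p, h p (f ord0 p) (f ord0 p) < 1) ->
  exists f' : 'I_N -> forall p, E p, parseval_frame h f'.
Proof.
move=> [sf fP] f1; have oT := @openT M.
have sf' j : section_on setT (f j).
  by move=> t Et l; rewrite setTI; exact: sf.
pose g := f ord0.
pose a p : R := complex.Re (h p (g p) (g p)).
have aE p : h p (g p) (g p) = (a p)%:C%C.
  by apply: real_of_nonneg; exact: hform_ge0.
have a1 p : a p < 1 by rewrite -ltcR -aE; exact: f1.
pose c p : C := (shrink_coef (a p))%:C%C.
have sa : smooth_fun_on setT (fun p => 1 - a p).
  apply: smooth_fun_onD => //; first exact: smooth_fun_on_cst.
  apply: smooth_fun_onN => //.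
  by case: (csmooth_hform h oT (sf' ord0) (sf' ord0)).
have a1' p : [set: M] p -> 0 < 1 - a p by move=> _; rewrite subr_gt0.
have sc : csmooth_fun_on setT c.
  apply: csmooth_fun_on_real; apply: smooth_fun_onM => //.
    exact: smooth_fun_on_powR.
  apply: smooth_fun_on_powR => //.
    by move=> p _; apply: ltr_pwDl => //; exact: powR_ge0.
  apply: smooth_fun_onD => //; first exact: smooth_fun_on_cst.
  exact: smooth_fun_on_powR.
exists (fun i p => f (lift ord0 i) p + (c p * h p (f (lift ord0 i) p) (g p)) *: g p).
split=> [i|p v].
  have sci := csmooth_fun_onM oT sc (csmooth_hform h oT (sf' (lift ord0 i)) (sf' ord0)).
  exact: section_onT (section_onD oT (sf' _) (section_onZ oT sci (sf' ord0))).
pose T := v + (c p * h p v (g p)) *: g p.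
have cc : (c p)^* = c p by exact: conj_real.
have hT w : h p v (w + (c p * h p w (g p)) *: g p) = h p T w.
  rewrite /T hformDr hformZr hformDl hformZl rmorphM /= cc -hform_conj; congr (_ + _).
  by rewrite -!mulrA; congr (_ * _); rewrite mulrC.
under eq_bigr do rewrite hT.
have := fP p T; rewrite big_ord_recl => /(canRL (addKr _)) ->.
set b := h p v (g p); set z := c p in cc T hT *.
have TT : h p T T = h p v v + (2 * z + z ^+ 2 * (a p)%:C%C) * (b * b^*).
  rewrite hformDl !hformDr !hformZl !hformZr aE -/b rmorphM /= cc (hform_conj h (g p) v) -/b.
  by ring.
have Tg : h p T (g p) = b * (1 + z * (a p)%:C%C).
  by rewrite hformDl hformZl aE -/b; ring.
have key : 2 * z + z ^+ 2 * (a p)%:C%C = (1 + z * (a p)%:C%C) ^+ 2.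
  rewrite /z /c -(rmorph_nat (real_complex R)) -!rmorphXn -!rmorphM -rmorphD shrink_coefP //.
  by rewrite rmorphXn rmorphD rmorph1.
rewrite -/(g) Tg TT key normCK rmorphM rmorphD rmorph1 rmorphM /= cc conj_real.
by ring.
Qed.

Lemma parseval_reduce N : compact [set: M] -> (d./2 + k <= N)%N ->
  (exists f : 'I_N.+1 -> forall p, E p, parseval_frame h f) ->
  exists f : 'I_N -> forall p, E p, parseval_frame h f.
Proof.
move=> cM dkN [f fP]; have oT := @openT M.
have sf j : section_on setT (f j).
  by move=> t Et l; rewrite setTI; case: fP => sf _; exact: sf.
have [|p||w wP] := @generic_nonfixed_complex R d M N.+1 k
    (fun p => \matrix_(i, j) h p (f i p) (f j p)) cM.
- by move=> i j; under eq_fun do rewrite mxE; exact: (csmooth_hform h oT (sf i) (sf j)).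
- have [t Et tp] := trivs_cover E p.
  (* Expanding each f_i in a local frame factors the Gram matrix through C^k. *)
  exists (\matrix_(i, l) t p (f i p) 0 l), (\matrix_(l, j) h p (local_frame t l p) (f j p)).
  apply/matrixP => i j; rewrite !mxE {1}(local_frame_sum (f i p) tp) hform_suml.
  by apply: eq_bigr => l _; rewrite hformZl !mxE.
- by rewrite ltnS.
have [S uS wS] := unitary_first_row w.
apply: (parseval_drop_first (rotated_parseval uS fP)) => p.
have := @parseval_combination_lt _ _ _ _ _ h _ f p (row 0 S) fP.
under [X in h p X]eq_bigr do rewrite mxE.
under [X in h p _ X]eq_bigr do rewrite mxE.
apply; first by have /row_unitarymxP/(_ 0 0) := uS; rewrite eqxx.
(* Since w is a multiple of the first row of S, it would be fixed if that row were. *)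
apply: contra (wP p) => /eqP zE; have /sub_rVP[a ->] := wS.
by rewrite -scalemxAl zE.
Qed.

(** Padding a frame of size N with n zero sections gives n + N vectors, so N deletions lead exactly
    to n, whichever of N and n is larger. *)
Lemma parseval_frame_exists n : compact [set: M] -> (d./2 + k <= n)%N ->
  exists f : 'I_n -> forall p, E p, parseval_frame h f.
Proof.
move=> cM dkn; have [N [f /(parseval_frame_pad n)]] := exists_parseval_frame h cM.
rewrite addnC; elim: N {f} => [|N IH]; first by rewrite addn0.
rewrite addnS => /(parseval_reduce cM) H; apply/IH/H.
exact: leq_trans (leq_addr _ _).
Qed.

End DropVector.

(** * Frames and sections of the Parseval bundle *)

Section SynthesisMap.
Context (R : realType) (d : nat) (M : smoothManifold R d).
Context (k n : nat) (E : complexBundle M k) (h : hermitianStructure E).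
Local Notation C := (R[i]).

Section Fibre.
Context (p : M) (f : 'I_n -> E p).

Definition synthesis (x : 'rV[C]_n) : E p := \sum_j x 0 j *: f j.

Lemma synthesis_linear : linear synthesis.
Proof.
move=> a x y; rewrite /synthesis scaler_sumr -big_split; apply: eq_bigr => j _.
by rewrite !mxE scalerDl scalerA.
Qed.

HB.instance Definition _ :=
  @GRing.isLinear.Build C 'rV[C]_n (E p) _ synthesis synthesis_linear.

Definition analysis (v : E p) : 'rV[C]_n := \row_j h p v (f j).

Lemma analysis_linear : linear analysis.
Proof. by move=> a v w; apply/rowP => j; rewrite !mxE hformDl hformZl. Qed.

HB.instance Definition _ :=
  @GRing.isLinear.Build C (E p) 'rV[C]_n _ analysis analysis_linear.

Lemma synthesis_delta i : synthesis (delta_mx 0 i) = f i.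
Proof.
rewrite /synthesis (bigD1 i) //= mxE !eqxx scale1r big1 ?addr0 // => j /negPf ji.
by rewrite mxE ji andbF scale0r.
Qed.

Lemma analysis_adjoint x v : h p (synthesis x) v = dotmx x (analysis v).
Proof.
rewrite dotmx_sum hform_suml; apply: eq_bigr => j _.
by rewrite hformZl mxE -hform_conj.
Qed.

(* Polarization. *)
Lemma analysis_isometry :
  (forall v, \sum_j `|h p v (f j)| ^+ 2 = h p v v) ->
  forall v w, dotmx (analysis v) (analysis w) = h p v w.
Proof.
move=> fP; pose D v w := dotmx (analysis v) (analysis w) - h p v w.
have D0 v : D v v = 0.
  rewrite /D -fP dotmx_sum; apply/eqP; rewrite subr_eq0; apply/eqP/eq_bigr => j _.
  by rewrite mxE normCK.
have DD v w : D v w + D w v = 0.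
  have aD : analysis (v + w) = analysis v + analysis w by exact: linearD.
  rewrite -(D0 (v + w)) /D aD hformDl !hformDr linearDl !linearDr /=.
  have /subr0_eq -> := D0 v; have /subr0_eq -> := D0 w.
  rewrite /D; move: (dotmx _ _) (dotmx _ _) (h p v v) (h p v w) (h p w v) (h p w w) => *.
  by ring.
move=> v w; apply/eqP; rewrite -subr_eq0 -/(D v w).
have Dr : D v ('i *: w) = - 'i * D v w.
  have aZ : analysis ('i *: w) = 'i *: analysis w by exact: linearZ.
  by rewrite /D aZ hformZr linearZr_LR /= conjCi mulrBr.
have Dl : D ('i *: w) v = 'i * D w v.
  have aZ : analysis ('i *: w) = 'i *: analysis w by exact: linearZ.
  by rewrite /D aZ hformZl linearZl_LR /= mulrBr.
(* Antisymmetry of D at (v, i w) makes D symmetric; being antisymmetric as well, D vanishes. *)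
have := DD v ('i *: w); rewrite Dr Dl mulNr addrC -mulrBr => /eqP.
rewrite mulf_eq0 (negPf (neq0Ci _)) /= subr_eq0 => /eqP E1; have := DD v w.
by rewrite E1 => /eqP; rewrite -mulr2n mulrn_eq0.
Qed.

End Fibre.

Lemma parseval_frame_section (f : 'I_n -> forall p, E p) : parseval_frame h f ->
  exists A : forall p, hom_bundle n E p, parseval_section h A.
Proof.
move=> [sf fP]; pose F p := fun j => f j p.
exists (fun p => linfun (synthesis (F p))); split.
  move=> _ [t Et <-] j; case/mxvec_indexP: j => r s /=.
  apply: (csmooth_fun_on_eq _ _ (sf r t Et s)); first exact: triv_dom_open.
  by move=> p tp; rewrite lfunE /= mxvecE mxE lfunE /= synthesis_delta.
move=> p; exists (linfun (analysis (F p))).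
  by move=> x v; rewrite !lfunE /= analysis_adjoint.
apply/lfunP => v; rewrite comp_lfunE !lfunE /=.
(* The defect w = A A^* v - v satisfies <w, w> = 0, because <A A^* v, w> = <A^* v, A^* w> = <v, w>
   by the isometry property; positivity then forces w = 0. *)
apply/eqP; rewrite -subr_eq0; set w := _ - _; apply: contraT => w0.
have := hform_gt0 h w0.
rewrite {1}/w linearBl /= analysis_adjoint analysis_isometry ?subrr ?ltxx //.
Qed.

End SynthesisMap.

Theorem theorem4p2 (R : realType) (d k n : nat) (M : smoothManifold R d)
    (E : complexBundle M k) (h : hermitianStructure E)
    (compactM : compact [set: M]) (len : (d./2 + k <= n)%N) :
  (exists A : forall p, hom_bundle n E p, parseval_section h A) /\
  (exists f : 'I_n -> forall p, E p, parseval_frame h f).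
Proof.
have [f fP] := parseval_frame_exists h compactM len.
by split; [exact: parseval_frame_section fP|exists f].
Qed.
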